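(* For $n\ge 1$ let $k_n$ be the number of level two cheesy polyominoes (on the hexagonal tiling, counted up to translation) having exactly $n$ cells. Then there exist real constants $\kappa$ and $\lambda$, with decimal expansions $\kappa=0.121042\ldots$ and $\lambda=4.231836\ldots$ (i.e. $0.121042\le\kappa<0.121043$ and $4.231836\le\lambda<4.231837$), such that $$k_n\sim \kappa\,\lambda^n\qquad (n\to\infty),$$ i.e. $\lim_{n\to\infty} k_n/(\kappa\lambda^n)=1$.
   Context: Consider the regular hexagonal tiling of the Euclidean plane, oriented so that every hexagonal tile has two horizontal edges; tiles are called cells. A (hexagonal-celled) polyomino is a union of finitely many (at least one) cells whose interior is connected (for unions of hexagonal cells, this is equivalent to the union being connected). Two polyominoes are considered equal if and only if one is the image of the other under a translation. The cells of a polyomino $P$ are partitioned according to their horizontal projection (cells with the same projection onto the horizontal axis lie in the same block); each block is a column of $P$. Cells of the tiling with the same horizontal projection are stacked vertically, consecutive ones sharing a horizontal edge. A column need not be a connected set; its connected components are its maximal runs of vertically consecutive cells. If a column has two connected components, the gap (hole) between them is the set of cells of the tiling lying in that vertical stack strictly between the two components. Columns are ordered from left to right; the first column is the leftmost one, and two columns are adjacent if they are consecutive in this order. A polyomino $P$ is rightward-semi-directed if the first (leftmost) column of $P$ has no gap (i.e. is connected) and, in every pair of adjacent columns of $P$, every connected component of the right column has at least one edge in common with the left column. For an integer $m\ge 1$, a polyomino $P$ is a level $m$ cheesy polyomino if: (i) $P$ is rightward-semi-directed; (ii) every column of $P$ has at most two connected components; (iii) if a column of $P$ has two connected components, then the gap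 between the components consists of at most $m$ cells. *)

(* Defs.v *)
From mathcomp Require Export all_boot all_order all_algebra finmap.
From mathcomp Require Export all_classical.
From mathcomp Require Export reals topology normedtype sequences.
Export Order.TTheory GRing.Theory Num.Theory.
Export numFieldNormedType.Exports.

Set Implicit Arguments.
Unset Strict Implicit.
Unset Printing Implicit Defensive.

Local Open Scope fset_scope.
Local Open Scope classical_set_scope.
Local Open Scope ring_scope.

(* The cell (i, j) is the regular hexagon of unit side, with two horizontal
   edges, centred at the point (3/2 * i, sqrt 3 * (j + i/2)).  Thus i indexes
   the horizontal projections and j the height inside a vertical stack, and the
   translations of the plane that map a cell to a cell are exactly the
   translations by elements of the group int * int. *)
Definition cell := (int * int)%type.

(* Distinct cells share an edge iff their centres are at distance sqrt 3. *)
Definition share_edge (c d : cell) : bool :=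
  (d - c : int * int) \in
    [:: (0, 1); (0, -1); (1, 0); (1, -1); (-1, 0); (-1, 1)].

Definition edge_rel (A : {fset cell}) : rel A :=
  fun x y => share_edge (val x) (val y).

Definition cells_connected (A : {fset cell}) : Prop :=
  forall x y : A, connect (@edge_rel A) x y.

Definition component (A : {fset cell}) (x : A) : {fset cell} :=
  [fset val y | y : A in connect (@edge_rel A) x].

Definition components (A : {fset cell}) : {fset {fset cell}} :=
  [fset component x | x : A].

(* A union of cells is represented by the set of its cells; its interior is
   connected iff any two of its cells are joined by a path of cells of the set
   in which consecutive cells share an edge. *)
Definition polyomino (P : {fset cell}) : Prop :=
  P != fset0 /\ cells_connected P.

Definition column (P : {fset cell}) (i : int) : {fset cell} :=
  [fset c in P | c.1 == i].

(* column P i is empty when no cell of P has abscissa i; the columns of P are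
   the nonempty ones. *)
Definition is_column (P : {fset cell}) (i : int) : Prop :=
  column P i != fset0.

Definition first_column (P : {fset cell}) (i : int) : Prop :=
  is_column P i /\ forall j : int, is_column P j -> i <= j.

Definition adjacent_columns (P : {fset cell}) (i j : int) : Prop :=
  [/\ is_column P i, is_column P j, i < j &
      forall l : int, is_column P l -> ~~ (i < l < j)].

Definition rightward_semi_directed (P : {fset cell}) : Prop :=
  (forall i, first_column P i -> cells_connected (column P i)) /\
  (forall i j, adjacent_columns P i j ->
     forall C : {fset cell}, C \in components (column P j) ->
       exists c d : cell, [/\ c \in C, d \in column P i & share_edge c d]).

(* Cells of the stack i lying above all of C and below all of D; it is empty
   when C is above D. *)
Definition gap (i : int) (C D : {fset cell}) : set cell :=
  [set c | [/\ c.1 = i, (forall x : cell, x \in C -> x.2 < c.2)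
             & (forall y : cell, y \in D -> c.2 < y.2)]].

Definition cheesy (m : nat) (P : {fset cell}) : Prop :=
  [/\ polyomino P,
      rightward_semi_directed P,
      (forall i, (#|` components (column P i)| <= 2)%N) &
      (forall (i : int) (C D : {fset cell}), C \in components (column P i) ->
         D \in components (column P i) -> C != D ->
         (gap i C D #<= `I_m)%card)].

Definition translate (t : cell) (P : {fset cell}) : {fset cell} :=
  [fset (c + t : int * int) | c in P].

Definition translation_class (P : {fset cell}) : set {fset cell} :=
  [set Q | exists t, Q = translate t P].

Definition cheesy_classes (m n : nat) : set (set {fset cell}) :=
  translation_class @` [set P | cheesy m P /\ #|` P| = n].

Definition num_cheesy (m n : nat) : nat := #|` fset_set (cheesy_classes m n)|.

(* Main.v *)
Require Import Defs.
From mathcomp Require Import zify ring lra.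

(** A cheesy polyomino is coded by the list of its columns, each one a height
    together with the sizes (a, h, b) of its lower run, gap and upper run.  The
    number of positions in which a column of given shape can be attached to the
    right of another depends on the latter only through whether its gap has two
    cells, the height of its convex hull and whether some of its runs have a
    single cell.  Summing these weights over all words of n cells gives five
    integer sequences tied by convolutions with polynomial kernels, hence a
    linear system; eliminating, k_n satisfies a recurrence of order 11 for n >= 2.

    Let chi be its characteristic polynomial and x the root of chi near 4.2318.
    The sequence u_n = k_(n+1) - x k_n satisfies the recurrence with
    characteristic polynomial q = chi / (X - x).  All the coefficients of
    q (X^3 + 5 X^2 + 16 X + 45) below the leading one are so small that
    u_n = O(4^n).  Applying synthetic division a second time expresses
    k_n chi'(x) as c x^n plus a fixed linear combination of u_n, ..., u_(n+9),
    where c is a combination of the initial values; so k_n / x^n converges, and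
    rational enclosures of x and of the coefficients of q give the digits. *)

Set Implicit Arguments.
Unset Strict Implicit.
Unset Printing Implicit Defensive.

Local Open Scope classical_set_scope.
Local Open Scope fset_scope.
Local Open Scope ring_scope.

(** * Connectivity inside a vertical stack *)

Lemma share_edgeE (c d : cell) :
  share_edge c d = [|| (d.1 == c.1) && ((d.2 == c.2 + 1) || (d.2 == c.2 - 1)),
    (d.1 == c.1 + 1) && ((d.2 == c.2) || (d.2 == c.2 - 1)) |
    (d.1 == c.1 - 1) && ((d.2 == c.2) || (d.2 == c.2 + 1))].
Proof.
case: c d => [i y] [k z]; rewrite /share_edge !inE /= !xpair_eqE /=; lia.
Qed.

Lemma share_edge_sym (c d : cell) : share_edge c d = share_edge d c.
Proof. by rewrite !share_edgeE; lia. Qed.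

(** Stated for bare cells rather than elements of the subtype [A], so that paths inside different
    sets can be compared. *)
Definition linked (A : {fset cell}) (c d : cell) : Prop :=
  exists (cA : c \in A) (dA : d \in A), connect (@edge_rel A) [` cA] [` dA].

Lemma linked_val (A : {fset cell}) (x y : A) :
  connect (@edge_rel A) x y <-> linked A (val x) (val y).
Proof.
by split=> [xy|[xA [yA]]]; first exists (valP x), (valP y); rewrite !fsetsubE.
Qed.

Lemma linked_refl (A : {fset cell}) (c : cell) : c \in A -> linked A c c.
Proof. by move=> cA; exists cA, cA. Qed.

Lemma edge_connect_sym (A : {fset cell}) : connect_sym (@edge_rel A).
Proof. by apply: sym_connect_sym => x y; rewrite /edge_rel share_edge_sym. Qed.

Lemma linked_sym (A : {fset cell}) (c d : cell) : linked A c d -> linked A d c.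
Proof. by move=> [cA [dA cd]]; exists dA, cA; rewrite edge_connect_sym. Qed.

Lemma linked_trans (A : {fset cell}) (c d e : cell) :
  linked A c d -> linked A d e -> linked A c e.
Proof.
move=> [cA [dA cd]] [dA' [eA de]]; exists cA, eA; apply: connect_trans cd _.
by rewrite (bool_irrelevance dA dA').
Qed.

Lemma linked_edge (A : {fset cell}) (c d : cell) :
  c \in A -> d \in A -> share_edge c d -> linked A c d.
Proof. by move=> cA dA cd; exists cA, dA; apply: connect1. Qed.

Lemma linked_ind (A : {fset cell}) (Q : cell -> Prop) (c d : cell) :
  linked A c d -> Q c ->
  (forall x y : cell, x \in A -> y \in A -> share_edge x y -> Q x -> Q y) -> Q d.
Proof.
move=> [cA [dA /connectP [p pth lst]]] Qc ext.
have H (q : seq A) x : path (@edge_rel A) x q -> Q (val x) -> Q (val (last x q)).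
  elim: q x => [|y q IH] x //= /andP[xy yq] Qx; apply: IH yq _.
  by apply: ext xy Qx; apply: valP.
by have := H p [` cA] pth Qc; rewrite -lst.
Qed.

Lemma linkedS (A B : {fset cell}) (c d : cell) :
  A `<=` B -> linked A c d -> linked B c d.
Proof.
move=> /fsubsetP AB cd; have [cA _] := cd; apply: (linked_ind cd).
  exact/linked_refl/AB.
move=> x y xA yA xy cx; apply: (linked_trans cx).
by apply: linked_edge => //; apply: AB.
Qed.

Lemma linked_mem (A : {fset cell}) (c d : cell) :
  linked A c d -> c \in A /\ d \in A.
Proof. by case=> cA [dA _]. Qed.

Lemma cells_connectedE (A : {fset cell}) :
  cells_connected A <-> forall c d : cell, c \in A -> d \in A -> linked A c d.
Proof.
split=> [h c d cA dA|h x y]; last by apply/linked_val; apply: h; apply: valP.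
by exists cA, dA; apply: h.
Qed.

Lemma componentsP (A C : {fset cell}) :
  reflect (exists2 c : cell, c \in A & forall d : cell, d \in C <-> linked A c d)
          (C \in components A).
Proof.
apply: (iffP (imfsetP _ _ _ _)) => /= [[x _ ->]|[c cA hC]].
  exists (val x); first exact: valP.
  move=> d; split=> [/imfsetP[y /= xy ->]|xd]; first exact/linked_val.
  have [_ [dA _]] := xd; apply/imfsetP; exists [` dA] => //=.
  by rewrite inE; apply/linked_val.
exists [` cA] => //; apply/fsetP => d; apply/idP/imfsetP => /=.
  move=> /hC cd; have [_ [dA _]] := cd; exists [` dA] => //=.
  by rewrite inE; apply/linked_val.
move=> [y /= cy ->]; apply/hC; have cy' : connect (@edge_rel A) [` cA] y by move: cy; rewrite inE.
exact/(linked_val [` cA])/cy'.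
Qed.

Definition in_stack (i : int) (A : {fset cell}) := forall c : cell, c \in A -> c.1 = i.

(** Inside one stack each step of a path changes the height by exactly one, so a path from [y] to
    [z] cannot skip a height between them. *)
Lemma linked_stackP (i : int) (A : {fset cell}) (y z : int) : in_stack i A ->
  y <= z ->
  linked A (i, y) (i, z) <-> (forall w : int, y <= w <= z -> (i, w) \in A).
Proof.
move=> Ai yz; split=> [yzA|].
  have [yA _] := linked_mem yzA.
  (* The path may wander below [y], hence an invariant covering the heights between [y] and the
     current cell on either side. *)
  suff h (w : int) : (y <= w <= (i, z).2) || ((i, z).2 <= w <= y) -> (i, w) \in A.
    by move=> w yw; apply: h; rewrite yw.
  apply: (linked_ind (Q := fun c => forall w : int,
    (y <= w <= c.2) || (c.2 <= w <= y) -> (i, w) \in A) yzA) => [v|c d cA dA cd hc v].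
    by move=> yvy; have -> : v = y by move: yvy => /=; lia.
  have [->|vd yv] := eqVneq v d.2; first by rewrite -(Ai _ dA) -surjective_pairing.
  apply: hc; move: cd yv vd; rewrite share_edgeE (Ai _ cA) (Ai _ dA).
  by lia.
have [n ->] : exists n : nat, z = y + n%:Z by exists `|z - y|%N; lia.
elim: n => [|n IH] h.
  by rewrite addr0; apply/linked_refl/h; lia.
apply: (linked_trans (IH _)); first by move=> w yw; apply: h; lia.
by apply: linked_edge; rewrite ?share_edgeE /=; try apply: h; lia.
Qed.

Definition seg (i u : int) (l : nat) : {fset cell} :=
  [fset (i, u + k%:Z) | k in iota 0 l].

Lemma in_seg (i u : int) (l : nat) (c : cell) :
  (c \in seg i u l) = (c.1 == i) && (u <= c.2 < u + l%:Z).
Proof.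
apply/imfsetP/idP => /= [[k]|/andP[/eqP ci ul]].
  by rewrite mem_iota => kl -> /=; lia.
exists `|c.2 - u|%N; first by rewrite mem_iota; lia.
by rewrite -ci [LHS]surjective_pairing; congr pair; lia.
Qed.

Lemma card_seg (i u : int) (l : nat) : #|` seg i u l| = l.
Proof.
rewrite card_imfset /= ?size_iota // => [|x y [] /addrI []//].
by rewrite undup_id ?size_iota // iota_uniq.
Qed.

(** * Columns with at most two runs *)

Definition shape := (nat * nat * nat)%type.

(* (x, (a, h, b)) stands for a column whose lowest run consists of the a cells
   at heights x, ..., x + a - 1; if h > 0, a gap of h cells and a second run of
   b cells lie above it, and a connected column has h = b = 0. *)
Definition col := (int * shape)%type.

Definition wf_shape (m : nat) (t : shape) : bool :=
  let: (a, h, b) := t in (0 < a)%N && if h == 0%N then b == 0%N else (h <= m)%N && (0 < b)%N.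

Definition shape_size (t : shape) : nat := (t.1.1 + t.2)%N.

Definition lower (i : int) (c : col) := let: (x, (a, h, b)) := c in seg i x a.

Definition upper (i : int) (c : col) :=
  let: (x, (a, h, b)) := c in seg i (x + a%:Z + h%:Z) b.

Definition colset (i : int) (c : col) : {fset cell} := lower i c `|` upper i c.

Lemma in_colset (i : int) (c : col) (d : cell) :
  (d \in colset i c) = let: (x, (a, h, b)) := c in (d.1 == i) &&
     ((x <= d.2 < x + a%:Z) || (x + a%:Z + h%:Z <= d.2 < x + a%:Z + h%:Z + b%:Z)).
Proof. by case: c => x [[a h] b]; rewrite in_fsetU !in_seg andb_orr. Qed.

Lemma colset_stack (i : int) (c : col) : in_stack i (colset i c).
Proof. by case: c => x [[a h] b] d; rewrite in_colset => /andP[/eqP]. Qed.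

Lemma card_colset (i : int) (c : col) : #|` colset i c| = shape_size c.2.
Proof.
case: c => x [[a h] b]; rewrite cardfsU !card_seg.
rewrite [X in #|` X|](_ : _ = fset0) ?cardfs0 ?subn0 //.
by apply/fsetP => d; rewrite in_fsetI !in_seg inE; lia.
Qed.

(** When [h > 0], a path between the two runs would have to cross the missing cell at height
    [x + a]; when [h = 0], the upper run is empty. *)
Lemma linked_colset (i x : int) (a h b : nat) (y z : int) :
  (0 < a)%N -> (if h == 0%N then b == 0%N else (0 < b)%N) ->
  let c := (x, (a, h, b)) in
  linked (colset i c) (i, y) (i, z) <->
  ((i, y) \in lower i c /\ (i, z) \in lower i c) \/
  ((i, y) \in upper i c /\ (i, z) \in upper i c).
Proof.
move=> a0 hb c; wlog yz : y z / y <= z.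
  move=> H; case: (leP y z) => [/H //|/ltW/H h']; split.
    by move/linked_sym/h'; tauto.
  by move=> ?; apply/linked_sym/h'; tauto.
split=> [l|].
  have [yA zA] := linked_mem l.
  move: (l); rewrite linked_stackP // => [H|]; last exact: colset_stack.
  have {}H (w : int) : y <= w <= z -> ~~ (x + a%:Z <= w < x + a%:Z + h%:Z).
    by move/H; rewrite in_colset /=; lia.
  move: yA zA; rewrite !in_colset /= !in_seg /=.
  have := H (x + a%:Z); case: ifP hb; lia.
(* Conversely, any segment contained in the column links its own cells. *)
have sub (B : {fset cell}) : B `<=` colset i c ->
  forall u l, B = seg i u l -> (i, y) \in B /\ (i, z) \in B ->
  linked (colset i c) (i, y) (i, z).
  move=> BA u l BE [yB zB]; apply: (linkedS BA); apply/linked_stackP => //.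
    by rewrite BE => d; rewrite in_seg => /andP[/eqP].
  by move: yB zB; rewrite BE !in_seg /= => ? ? w ?; rewrite in_seg /=; lia.
case=> H; first exact: (sub (lower i c) (fsubsetUl _ _) x a erefl H).
exact: (sub (upper i c) (fsubsetUr _ _) (x + a%:Z + h%:Z) b erefl H).
Qed.

Lemma components_colset (m : nat) (i : int) (c : col) (C : {fset cell}) :
  wf_shape m c.2 ->
  C \in components (colset i c) <->
  C = lower i c \/ (0 < c.2.1.2)%N /\ C = upper i c.
Proof.
case: c => x [[a h] b] /= /andP[a0 hb].
have hb' : if h == 0%N then b == 0%N else (0 < b)%N by case: ifP hb; lia.
(* A nonempty segment closed under linking in both directions is a component; this is applied to
   each run. *)
have cmp B u l : B = seg i u l -> (0 < l)%N ->
    (forall y z, (i, y) \in B ->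
      linked (colset i (x, (a, h, b))) (i, y) (i, z) <-> (i, z) \in B) ->
    B \in components (colset i (x, (a, h, b))).
  move=> BE l0 H; have uB : (i, u) \in B by rewrite BE in_seg /=; lia.
  have uu : linked (colset i (x, (a, h, b))) (i, u) (i, u) by apply/H.
  have [uA _] := linked_mem uu; apply/componentsP; exists (i, u) => // -[k z].
  case: (k =P i) => [->|ki]; first by split=> /H; apply.
  split; first by rewrite BE in_seg /=; lia.
  by move=> /linked_mem[_ /colset_stack] /=.
split=> [/componentsP [[k y] yA hC]|[->|[h0 ->]]].
- have ki := colset_stack yA; move: ki => /= ki; subst k.
  have E B u l : B = seg i u l -> (forall z,
      linked (colset i (x, (a, h, b))) (i, y) (i, z) <-> (i, z) \in B) -> C = B.
    move=> BE H; apply/fsetP => -[k z]; case: (k =P i) => [->|ki].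
      by apply/idP/idP => [/hC/H|/H/hC].
    apply/idP/idP => [/hC/linked_mem[_ /colset_stack]/= //|].
    by rewrite BE in_seg /=; lia.
  move: (yA); rewrite in_fsetU => /orP[yl|yu].
    left; apply: E => // z; rewrite linked_colset // /= yl.
    by move: yl; rewrite !in_seg /=; split; [case; lia|lia].
  right; split; first by move: yu hb'; rewrite in_seg /=; case: ifP; lia.
  apply: E => // z; rewrite linked_colset // /= yu.
  by move: yu; rewrite !in_seg /=; split; [case; lia|lia].
- apply: cmp => // y z yl; rewrite linked_colset // /= yl.
  by move: yl; rewrite !in_seg /=; split; [case; lia|lia].
- apply: cmp => // [|y z yl]; first by case: ifP hb' h0; lia.
  rewrite linked_colset // /= yl.
  by move: yl; rewrite !in_seg /=; split; [case; lia|lia].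
Qed.

Lemma fset_cell_bounded (A : {fset cell}) :
  exists M : nat, forall c : cell, c \in A -> - M%:Z <= c.2 <= M%:Z.
Proof.
have bd (s : seq cell) :
    exists M : nat, forall c : cell, c \in s -> (`|c.2| <= M)%N.
  elim: s => [|d s [M hM]]; first by exists 0%N.
  by exists (`|d.2| + M)%N => c; rewrite inE => /orP[/eqP->|/hM]; lia.
by have [M hM] := bd (enum_fset A); exists M => c /hM; lia.
Qed.

(** The predicate [p] allows two uses: the bottom of the first run, and the lowest cell outside that
    run. *)
Lemma lowest_cell (i : int) (A : {fset cell}) (p : pred cell) (c0 : cell) :
  in_stack i A -> c0 \in A -> p c0 ->
  exists x : int, [/\ (i, x) \in A, p (i, x) &
    forall y : int, (i, y) \in A -> p (i, y) -> x <= y].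
Proof.
move=> Ai c0A pc0; have [M hM] := fset_cell_bounded A.
pose q n := ((i, n%:Z - M%:Z) \in A) && p (i, n%:Z - M%:Z).
have c0E : c0 = (i, c0.2) by rewrite -(Ai _ c0A) -surjective_pairing.
have exq : exists n, q n.
  exists `|(c0.2 + M%:Z)%R|%N; have := hM _ c0A => ?.
  by rewrite /q (_ : _ - _ = c0.2) -?c0E ?c0A //; lia.
case: (ex_minnP exq) => n /andP[nA pn] min; exists (n%:Z - M%:Z); split=> // y yA py.
have := hM _ yA => /= ?; have := min `|(y + M%:Z)%R|%N.
by rewrite /q (_ : _ - _ = y) ?yA ?py; lia.
Qed.

Lemma run_above (i x : int) (A : {fset cell}) : (i, x) \in A ->
  exists l : nat, [/\ (0 < l)%N, (i, x + l%:Z) \notin A &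
    forall y : int, x <= y < x + l%:Z -> (i, y) \in A].
Proof.
move=> xA; have [M hM] := fset_cell_bounded A.
have exq : exists n : nat, (i, x + n%:Z) \notin A.
  exists (`|x| + M).+1; apply/negP => /hM /=; lia.
case: (ex_minnP exq) => l nA min; exists l; split=> // [|y yl].
  by case: l nA {min} => //; rewrite addr0 xA.
apply/negP => /negP yA; have := min `|y - x|%N.
by rewrite (_ : x + _ = y); [move/(_ yA); lia | lia].
Qed.

Lemma component_run (i x : int) (l : nat) (A : {fset cell}) : in_stack i A ->
  (i, x) \in A -> (i, x - 1) \notin A -> (0 < l)%N -> (i, x + l%:Z) \notin A ->
  (forall y : int, x <= y < x + l%:Z -> (i, y) \in A) -> seg i x l \in components A.
Proof.
move=> Ai xA x1A l0 xlA run; apply/componentsP; exists (i, x) => // -[k y].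
rewrite in_seg /=; case: (k =P i) => [->|ki]; last first.
  by split=> // /linked_mem[_ /Ai].
rewrite /=; split=> [xy|xyl].
  by apply/linked_stackP => // [|w wy]; [lia|apply: run; lia].
have [yx|yx] := ltP y x.
  move/linked_sym: xyl; rewrite linked_stackP //; last lia.
  by move=> /(_ (x - 1)) h; move: x1A; rewrite h //; lia.
move: xyl; rewrite linked_stackP //.
move=> /(_ (x + l%:Z)) h; apply: contraNT xlA => ?; apply: h; lia.
Qed.

Lemma gap_card (i x y : int) (l b m : nat) : (0 < l)%N -> (0 < b)%N -> x + l%:Z <= y ->
  (gap i (seg i x l) (seg i y b) #<= `I_m)%card <-> y <= x + l%:Z + m%:Z.
Proof.
move=> l0 b0 xy.
pose f (k : nat) : cell := (i, x + l%:Z + k%:Z).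
have -> : gap i (seg i x l) (seg i y b) = [set f k | k in `I_(`|(y - (x + l%:Z))%R|)].
  apply/seteqP; split=> [[k z] [/= -> h1 h2]|c [k /= km <-]].
    exists `|(z - (x + l%:Z))%R|%N => /=.
      have := h1 (i, x + l%:Z - 1); have := h2 (i, y).
      rewrite !in_seg /=; lia.
    rewrite /f; congr pair; have := h1 (i, x + l%:Z - 1); rewrite in_seg /=; lia.
  by split=> //= d; rewrite in_seg => /andP[_ dl]; rewrite /f /=; lia.
have finj : {in `I_(`|(y - (x + l%:Z))%R|) &, injective f}.
  by move=> u v _ _ [] /addrI [].
by rewrite (card_le_eql (inj_card_eq finj)) card_le_II; lia.
Qed.

Lemma mem_components (A : {fset cell}) (c : cell) : c \in A ->
  exists2 C : {fset cell}, C \in components A &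
    forall d : cell, d \in C <-> linked A c d.
Proof.
move=> cA; have [C CE] : exists C : {fset cell}, forall d : cell, d \in C <-> linked A c d.
  exists [fset d in A | `[< linked A c d >]] => d; rewrite !inE.
  split; first by move=> /andP[_ /asboolP].
  by move=> l; have [_ ->] := linked_mem l; apply/asboolP.
by exists C => //; apply/componentsP; exists c.
Qed.

(** The lowest cell starts one maximal run and the lowest cell outside that run starts another. Both
    are components, so the bound of two components leaves nothing else. *)
Lemma column_colset (m : nat) (i : int) (A : {fset cell}) :
  in_stack i A -> A != fset0 -> (#|` components A| <= 2)%N ->
  (forall C D : {fset cell}, C \in components A -> D \in components A -> C != D ->
     (gap i C D #<= `I_m)%card) ->
  exists2 c : col, wf_shape m c.2 & A = colset i c.
Proof.
move=> Ai /fset0Pn[c0 c0A] cmp2 gapm.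
have [x [xA _ xmin]] := lowest_cell (p := predT) Ai c0A isT.
have [a [a0 xaA runa]] := run_above xA.
have C1 : seg i x a \in components A.
  by apply: component_run => //; apply/negP => /xmin/(_ isT); lia.
case: (boolP (A `<=` seg i x a)) => [Asub|/fsubsetPn[c1 c1A c1S]].
  exists (x, (a, 0%N, 0%N)); first by rewrite /= a0.
  apply/eqP; rewrite eqEfsubset; apply/andP; split.
    by apply: fsubset_trans Asub _; apply: fsubsetUl.
  apply/fsubsetP => -[k y]; rewrite in_colset /= => /andP[/eqP -> H].
  by apply: runa; lia.
have [y [yA yS ymin]] := lowest_cell (p := fun c => c \notin seg i x a) Ai c1A c1S.
have [b [b0 ybA runb]] := run_above yA.
have xay : x + a%:Z < y.
  have := xmin _ yA isT; move: yS; rewrite in_seg /= => H1 H2.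
  rewrite lt_neqAle; apply/andP; split; last lia.
  by apply: contraTneq yA => <-.
have C2 : seg i y b \in components A.
  apply: component_run => //; apply/negP => y1A.
  by have := ymin _ y1A; rewrite in_seg /=; clear -xay; lia.
have C12 : seg i x a != seg i y b.
  by apply/eqP => /fsetP/(_ (i, x)); rewrite !in_seg /=; clear -xay a0; lia.
have := gapm _ _ C1 C2 C12; rewrite gap_card //; last exact: ltW.
move=> hm.
exists (x, (a, `|(y - (x + a%:Z))%R|%N, b)); first by rewrite /= a0 /= b0; clear -xay hm; case:
  ifP; lia.
apply/fsetP => -[k z]; rewrite in_colset /=; apply/idP/idP; last first.
  move=> /andP[/eqP ->] /orP[H|H]; first exact: runa.
  by apply: runb; clear -H xay; lia.
move=> kzA; have /= ki := Ai _ kzA; subst k; rewrite eqxx /=.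
have [C CA zC] := mem_components kzA; have {}zC := (zC _).2 (linked_refl kzA).
(* Two distinct components in a set of at most two components make up all of them. *)
have : C \in [fset seg i x a; seg i y b].
  suff -> : [fset seg i x a; seg i y b] = components A by [].
  apply/eqP; rewrite eqEfcard cardfs2 C12 cmp2 andbT.
  by apply/fsubsetP => D; rewrite !inE => /orP[]/eqP->.
by rewrite !inE => /orP[]/eqP CE; move: zC; rewrite CE in_seg /=; clear -xay; lia.
Qed.

(** * Words of columns *)

(** The ends of the runs are recovered from the bottom up, testing the two sets at the heights where
    one of the two descriptions changes. Well-formedness excludes an upper run glued to the lower
    one. *)
Lemma colset_inj (m i : nat) (c d : col) :
  wf_shape m c.2 -> wf_shape m d.2 -> colset i c = colset i d -> c = d.
Proof.
case: c d => [x [[a h] b]] [x' [[a' h'] b']] /= wc wd /fsetP E.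
have {}E (y : int) : ((x <= y < x + a%:Z) || (x + a%:Z + h%:Z <= y < x + a%:Z + h%:Z + b%:Z))
    = ((x' <= y < x' + a'%:Z) || (x' + a'%:Z + h'%:Z <= y < x' + a'%:Z + h'%:Z + b'%:Z)).
  by have := E ((i%:Z, y) : cell); rewrite !in_colset /= eqxx.
have Ex : x = x'.
  have := E x; have := E x'; clear E; move: wc wd.
  by case: ifP; case: ifP; lia.
subst x'; have Ea : a = a'.
  have := E (x + a%:Z); have := E (x + a'%:Z); clear E; move: wc wd.
  by case: ifP; case: ifP; lia.
subst a'; have Eh : h = h'.
  have := E (x + a%:Z + h%:Z); have := E (x + a%:Z + h'%:Z); clear E; move: wc wd.
  by case: ifP; case: ifP; lia.
subst h'; congr (_, (_, _, _)).
have := E (x + a%:Z + h%:Z + b%:Z); have := E (x + a%:Z + h%:Z + b'%:Z).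
by clear E; move: wc wd; case: ifP; lia.
Qed.

Lemma colset_neq0 (m : nat) (i : int) (c : col) : wf_shape m c.2 -> colset i c != fset0.
Proof.
case: c => x [[a h] b] /= /andP[a0 _]; apply/fset0Pn; exists (i, x).
by rewrite in_colset /= eqxx; lia.
Qed.

(** A cell at height [y] has the heights [y] and [y + 1] as neighbours in the stack on its left. A
    run at heights [u], ..., [u + l - 1] therefore touches the heights [u], ..., [u + l], which
    explains the inequalities, strict on one side only. *)
Definition meets (c' : col) (u : int) (l : nat) : bool :=
  let: (x, (a, h, b)) := c' in
  (u < x + a%:Z) && (x <= u + l%:Z) ||
  [&& (0 < h)%N, u < x + a%:Z + h%:Z + b%:Z & x + a%:Z + h%:Z <= u + l%:Z].

Definition link (c' c : col) : bool :=
  let: (x, (a, h, b)) := c in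
  meets c' x a && ((h == 0%N) || meets c' (x + a%:Z + h%:Z) b).

Lemma meetsP (m : nat) (i : int) (c' : col) (u : int) (l : nat) :
  wf_shape m c'.2 -> (0 < l)%N ->
  meets c' u l <-> exists c d : cell,
    [/\ c \in seg (i + 1) u l, d \in colset i c' & share_edge c d].
Proof.
case: c' => x [[a h] b] /= /andP[a0 hb] l0; split; last first.
  move=> [[k y] [[k' z] [+ + +]]]; rewrite in_seg in_colset share_edgeE /=.
  by move: hb; case: ifP; lia.
move=> H; have [y [z [H1 H2 H3]]] : exists y z : int, [/\ u <= y < u + l%:Z,
   (x <= z < x + a%:Z) || (x + a%:Z + h%:Z <= z < x + a%:Z + h%:Z + b%:Z) &
   (z == y) || (z == y + 1)].
  case/orP: H => [H|/andP[h0 H]].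
    by have [xu|ux] := leP x u; [exists u, u | exists (x - 1), x]; split; lia.
  have {}hb : (0 < b)%N by move: hb h0; case: ifP; lia.
  have [xu|ux] := leP (x + a%:Z + h%:Z) u.
    by exists u, u; split; lia.
  by exists (x + a%:Z + h%:Z - 1), (x + a%:Z + h%:Z); split; lia.
exists (i + 1, y), (i, z); rewrite in_seg in_colset share_edgeE /=.
by clear -H1 H2 H3; split; lia.
Qed.

Lemma link_components (m : nat) (i : int) (c' c : col) :
  wf_shape m c'.2 -> wf_shape m c.2 ->
  link c' c <-> (forall C : {fset cell}, C \in components (colset (i + 1) c) ->
    exists x y : cell, [/\ x \in C, y \in colset i c' & share_edge x y]).
Proof.
move=> wc' wc; case: c wc => x [[a h] b] wc /=.
have /andP[a0 hb] := wc.
have b0 : (0 < h)%N -> (0 < b)%N by move: hb; case: ifP; lia.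
split=> [/andP[ma mb] C|H].
  move/(components_colset _ _ wc) => [->|[/= h0 ->]] /=.
    exact/(meetsP _ _ wc').
  by apply/(meetsP _ _ wc'); [exact: b0|move: mb; rewrite eqn0Ngt h0].
apply/andP; split.
  by apply/(meetsP i _ wc') => //; apply: H; apply/(components_colset _ _ wc); left.
rewrite eqn0Ngt; case: (ltnP 0 h) => //= h0.
apply/(meetsP i _ wc'); first exact: b0.
by apply: H; apply/(components_colset _ _ wc); right.
Qed.

Definition col0 : col := (0, (0%N, 0%N, 0%N)).

Definition next_col (m : nat) (c' c : col) : bool := wf_shape m c.2 && link c' c.

(** Putting the first column at height 0 selects one representative of each translation class; its
    zero gap expresses that it is connected. *)
Definition word (m : nat) (w : seq col) : bool :=
  if w is c :: s then
    [&& c.1 == 0, c.2.1.2 == 0%N, wf_shape m c.2 & path (next_col m) c s]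
  else false.

Definition word_size (w : seq col) : nat := sumn [seq shape_size c.2 | c <- w].

(** * From words to cheesy polyominoes *)

Definition cells_of (w : seq col) : {fset cell} :=
  \big[fsetU/fset0]_(k < size w) colset k%:Z (nth col0 w k).

Lemma in_cells_of (w : seq col) (c : cell) :
  c \in cells_of w <->
  exists2 k : nat, (k < size w)%N & c \in colset k%:Z (nth col0 w k).
Proof.
split=> [/bigfcupP[k _ ck]|[k kw ck]]; first by exists k.
by apply/bigfcupP; exists (Ordinal kw); rewrite ?mem_index_enum.
Qed.

Lemma in_column (P : {fset cell}) (i : int) (c : cell) :
  (c \in column P i) = (c \in P) && (c.1 == i).
Proof. by rewrite !inE. Qed.

Lemma column_cells_of (w : seq col) (k : nat) : (k < size w)%N ->
  column (cells_of w) k%:Z = colset k%:Z (nth col0 w k).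
Proof.
move=> kw; apply/fsetP => c; rewrite in_column; apply/andP/idP.
  move=> [/in_cells_of[l lw cl]] /eqP ck.
  by have := colset_stack cl; rewrite ck => -[->].
move=> cc; split; last by rewrite (colset_stack cc).
by apply/in_cells_of; exists k.
Qed.

Lemma is_column_cells_of (m : nat) (w : seq col) (i : int) :
  all (fun c : col => wf_shape m c.2) w ->
  is_column (cells_of w) i <-> exists2 k : nat, (k < size w)%N & i = k%:Z.
Proof.
move=> ww; split=> [/fset0Pn[c]|[k kw ->]].
  rewrite in_column => /andP[/in_cells_of[k kw ck] /eqP ci].
  by exists k => //; rewrite -ci (colset_stack ck).
rewrite /is_column column_cells_of //; apply: (@colset_neq0 m).
by move/all_nthP: ww; apply.
Qed.

Lemma card_cells_of (w : seq col) : #|` cells_of w| = word_size w.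
Proof.
rewrite /word_size; elim/last_ind: w => [|w c IH].
  by rewrite /cells_of big_ord0 cardfs0.
rewrite map_rcons sumn_rcons -IH -(card_colset (size w)%:Z c).
rewrite /cells_of size_rcons big_ord_recr /= nth_rcons ltnn eqxx cardfsU.
rewrite (eq_bigr (fun k : 'I_(size w) => colset k%:Z (nth col0 w k))) => [|k _].
  rewrite -/(cells_of w) [X in (_ - #|` X|)%N](_ : _ = fset0) ?cardfs0 ?subn0 //.
  apply/fsetP => d; rewrite in_fsetI [RHS]inE; apply/negP => /andP[].
  move=> /in_cells_of[k kw /colset_stack dk] /colset_stack.
  by rewrite dk => -[E]; rewrite E ltnn in kw.
by rewrite nth_rcons ltn_ord.
Qed.

Lemma word_wf (m : nat) (w : seq col) :
  word m w -> all (fun c : col => wf_shape m c.2) w.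
Proof.
case: w => //= c s /and4P[_ _ -> /=]; elim: s c => //= d s IH c /andP[/andP[-> _] /IH].
by [].
Qed.

Lemma word_link (m : nat) (w : seq col) (k : nat) : word m w -> (k.+1 < size w)%N ->
  link (nth col0 w k) (nth col0 w k.+1).
Proof.
case: w => //= c s /and4P[_ _ _ /(pathP col0) H] ks.
by have /andP[] := H k ks.
Qed.

Lemma word_cheesy (m : nat) (w : seq col) : word m w -> cheesy m (cells_of w).
Proof.
move=> ww; have awf := word_wf ww.
have wfk k : (k < size w)%N -> wf_shape m (nth col0 w k).2 by move/all_nthP: awf; apply.
have w0 : (0 < size w)%N by case: w ww {awf wfk}.
have sub k : (k < size w)%N -> colset k%:Z (nth col0 w k) `<=` cells_of w.
  by move=> kw; apply/fsubsetP => c cc; apply/in_cells_of; exists k.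
have conn0 : cells_connected (colset 0 (nth col0 w 0)).
  case: w ww {awf sub w0} wfk => //= -[x [[a h] b]] s /and4P[/= _ /eqP h0 wc _] _; subst h.
  apply/cells_connectedE => -[k y] [k' z] yA zA.
  have /= kE := colset_stack yA; have /= k'E := colset_stack zA; subst k k'.
  have /andP[a0 /= /eqP b0] := wc; subst b; apply/linked_colset => //=; left.
  by move: yA zA; rewrite !in_colset !in_seg /=; lia.
(* Connectedness: the component of [c] in its column touches the previous column, so by induction
   every cell reaches the first column. *)
have to0 k c d : (k < size w)%N -> c \in colset k%:Z (nth col0 w k) ->
    d \in colset 0 (nth col0 w 0) -> linked (cells_of w) c d.
  elim: k c => [|k IH] c kw cc dd.
    by apply: (linkedS (sub 0%N kw)); move/cells_connectedE: conn0; apply.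
  have [C CC Cc] := mem_components cc.
  have := word_link ww kw; rewrite (link_components k%:Z (wfk _ (ltnW kw)) (wfk _ kw)).
  rewrite (_ : k%:Z + 1 = k.+1%:Z); last lia.
  move=> /(_ _ CC)[x [y [xC yk xy]]].
  have cx := linkedS (sub _ kw) ((Cc _).1 xC).
  apply: (linked_trans cx); apply: (linked_trans _ (IH _ (ltnW kw) yk dd)).
  apply: linked_edge xy; first by have [] := linked_mem cx.
  by apply: (fsubsetP (sub _ (ltnW kw))).
have colE i : is_column (cells_of w) i -> exists k : nat, [/\ (k < size w)%N, i = k%:Z &
    column (cells_of w) i = colset i (nth col0 w k)].
  move/(is_column_cells_of _ awf) => [k kw ->]; exists k; split=> //.
  exact: column_cells_of.
have ncol i : column (cells_of w) i = fset0 -> components (column (cells_of w) i) = fset0.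
  by move=> ->; apply/fsetP => C; rewrite [RHS]inE; apply/componentsP => -[c]; rewrite inE.
split.
- split.
    have /fset0Pn[c /(fsubsetP (sub _ w0)) cc] := colset_neq0 0 (wfk _ w0).
    by apply/fset0Pn; exists c.
  have /fset0Pn[o oo] := colset_neq0 0 (wfk _ w0).
  apply/cells_connectedE => c d /in_cells_of[k kw ck] /in_cells_of[l lw dl].
  by apply: linked_trans (to0 _ _ _ kw ck oo) _; apply/linked_sym/(to0 l).
- split=> [i [ci mi]|i j [ci cj ij adj] C].
    have -> : i = 0.
      have [k [_ ik _]] := colE i ci; have c0 : is_column (cells_of w) 0.
        by apply/(is_column_cells_of _ awf); exists 0%N.
      by have := mi _ c0; lia.
    by rewrite (column_cells_of w0).
  have [k [kw ik ->]] := colE _ ci; subst i.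
  have [l [lw jl ->]] := colE _ cj; subst j.
  have kl : l = k.+1.
    have ck1 : is_column (cells_of w) k.+1%:Z.
      by apply/(is_column_cells_of _ awf); exists k.+1 => //; lia.
    by have := adj _ ck1; lia.
  subst l; have := word_link ww lw.
  rewrite (link_components k%:Z (wfk _ kw) (wfk _ lw)) (_ : k%:Z + 1 = k.+1%:Z); last lia.
  exact.
- move=> i; case: (boolP (column (cells_of w) i == fset0)) => [/eqP/ncol->|].
    by rewrite cardfs0.
  move/colE => [k [kw _ ->]].
  have sub2 : components (colset i (nth col0 w k)) `<=`
      [fset lower i (nth col0 w k); upper i (nth col0 w k)].
    apply/fsubsetP => C /(components_colset _ _ (wfk _ kw)).
    by rewrite !inE => -[->|[_ ->]]; rewrite eqxx ?orbT.
  by apply: leq_trans (fsubset_leq_card sub2) _; rewrite cardfs2; case: (_ != _).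
- move=> i C D; case: (boolP (column (cells_of w) i == fset0)) => [/eqP/ncol->|].
    by rewrite inE.
  move/colE => [k [kw _ ->]].
  move: (wfk _ kw); case: (nth col0 w k) => x [[a h] b] wc.
  have /andP[a0 hb] := wc.
  move=> /(components_colset _ _ wc) /= CE /(components_colset _ _ wc) /= DE.
  case: CE => [->|[h0 ->]]; case: DE => [->|[h0' ->]]; rewrite ?eqxx // => _.
    move: hb; rewrite eqn0Ngt h0' /= => /andP[hm b0].
    by apply/gap_card; lia.
  (* The runs are now taken in the reverse order, and no cell is both above the upper run and below
     the lower one. *)
  rewrite (_ : gap i _ _ = set0) ?card_ge0 //; apply/seteqP; split=> // c [_ hc1 hc2].
  move: hb; rewrite eqn0Ngt h0 /= => /andP[hm b0].
  have := hc1 (i, x + a%:Z + h%:Z); have := hc2 (i, x); rewrite !in_seg /= eqxx /=.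
  by move=> /(_ _) h1 /(_ _) h2; lia.
Qed.

(** * Translations, and from polyominoes back to words *)

Definition shift (t : int) (c : col) : col := (c.1 + t, c.2).

Lemma in_colset_shift (i j s t : int) (c : col) (y : int) :
  ((i + s, y + t) \in colset (j + s) (shift t c)) = ((i, y) \in colset j c).
Proof. by case: c => x [[a h] b]; rewrite !in_colset /=; lia. Qed.

Lemma link_shift (t : int) (c' c : col) : link (shift t c') (shift t c) = link c' c.
Proof. by case: c' c => [x' [[a' h'] b']] [x [[a h] b]] /=; lia. Qed.

Lemma in_translate (t : cell) (P : {fset cell}) (c : cell) :
  (c \in translate t P) = ((c.1 - t.1, c.2 - t.2) \in P).
Proof.
apply/imfsetP/idP => /= [[[i y] dP ->]|cP]; first by rewrite /= !addrK.
exists (c.1 - t.1, c.2 - t.2) => //; rewrite [LHS]surjective_pairing.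
by congr pair; rewrite /= subrK.
Qed.

Lemma is_columnP (P : {fset cell}) (i : int) :
  is_column P i <-> exists y : int, (i, y) \in P.
Proof.
split=> [/fset0Pn[c]|[y yP]]; last first.
  by apply/fset0Pn; exists (i, y); rewrite in_column yP /=.
rewrite in_column => /andP[cP /eqP <-].
by exists c.2; rewrite -surjective_pairing.
Qed.

Lemma abscissae_bounded (P : {fset cell}) :
  exists M : nat, forall i : int, is_column P i -> - M%:Z <= i <= M%:Z.
Proof.
have [M hM] := fset_cell_bounded [fset (c.2, c.1) | c in P].
exists M => i /is_columnP[y yP]; apply: (hM (y, i)).
by apply/imfsetP; exists (i, y).
Qed.

Lemma leftmost_column (P : {fset cell}) : P != fset0 -> exists i, first_column P i.
Proof.
move=> /fset0Pn[c cP]; have [M hM] := abscissae_bounded P.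
have cc : is_column P c.1 by apply/is_columnP; exists c.2; rewrite -surjective_pairing.
pose q n := `[< is_column P (n%:Z - M%:Z) >].
have exq : exists n, q n.
  exists `|(c.1 + M%:Z)%R|%N; apply/asboolP.
  by have := hM _ cc => ?; rewrite (_ : _ - _ = c.1) //; lia.
case: (ex_minnP exq) => n /asboolP nP min; exists (n%:Z - M%:Z); split=> // j jP.
have /= ? := hM _ jP; have := min `|(j + M%:Z)%R|%N.
rewrite /q (_ : _ - _ = j); last lia.
by move=> /(_ (asboolT jP)); lia.
Qed.

(** The nearest nonempty column to the left of [i] is adjacent to it and shares an edge with it, and
    an edge joins abscissae that differ by at most one. *)
Lemma columns_contiguous (P : {fset cell}) (i0 i : int) :
  rightward_semi_directed P -> first_column P i0 -> is_column P i -> i0 < i ->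
  is_column P (i - 1).
Proof.
move=> [_ semi] [c0 min0] ci i0i.
(* The least such [n] is the distance to the nearest nonempty column on the left; the first column
   shows that one exists. *)
pose q n := (0 < n)%N && `[< is_column P (i - n%:Z) >].
have exq : exists n, q n.
  exists `|(i - i0)%R|%N; apply/andP; split; first lia.
  by apply/asboolP; rewrite (_ : i - _ = i0) //; lia.
case: (ex_minnP exq) => n /andP[n0 /asboolP nP] min.
have adj : adjacent_columns P (i - n%:Z) i.
  split=> //; first lia; move=> l cl; apply/negP => il.
  have := min `|(i - l)%R|%N; rewrite /q (_ : i - Posz _ = l); last by clear -il; lia.
  by rewrite asboolT //; lia.
have /fset0Pn[d dc] := ci; have [C CC _] := mem_components dc.
have [x [y [xC yc]]] := semi _ _ adj _ CC.
have /componentsP[e ec Ce] := CC.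
have [_ ] := linked_mem ((Ce x).1 xC).
move: yc; rewrite !in_column share_edgeE => /andP[_ /eqP ->] /andP[_ /eqP ->] H.
by rewrite (_ : 1 = n%:Z) //; lia.
Qed.

Lemma cheesy_word (m : nat) (P : {fset cell}) : cheesy m P ->
  exists w t, word m w /\ P = translate t (cells_of w).
Proof.
move=> [[P0 _] semi c2 gapm].
have [i0 fst0] := leftmost_column P0.
have [conn0 nxt] := semi.
have colP i : exists c : col, is_column P i -> wf_shape m c.2 /\ column P i = colset i c.
  have [ci|nci] := pselect (is_column P i); last by exists col0.
  have stk : in_stack i (column P i).
    by move=> d; rewrite in_column => /andP[_ /eqP].
  by have [c wc E] := column_colset stk ci (c2 i) (gapm i); exists c.
have [f hf] := choice colP.
(* [L] will be the first distance from [i0] at which the stack is empty; contiguity of the columns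
   makes it their number. *)
have exq : exists n : nat, ~~ `[< is_column P (i0 + n%:Z) >].
  have [M hM] := abscissae_bounded P; exists (`|i0| + M).+1.
  by apply/negP => /asboolP/hM; lia.
case: (ex_minnP exq) => L /asboolPn nL minL.
have colL k : (k < L)%N -> is_column P (i0 + k%:Z).
  by move=> kL; apply/asboolP; apply: contraTT kL => /minL; rewrite -leqNgt.
have ncolL i : is_column P i -> exists2 k : nat, (k < L)%N & i = i0 + k%:Z.
  move=> ci; have [c0 min0] := fst0; have ii0 := min0 _ ci.
  exists `|(i - i0)%R|%N; last lia.
  have [n En] : exists n : nat, i = i0 + n%:Z by exists `|(i - i0)%R|%N; lia.
  rewrite En (_ : i0 + n%:Z - i0 = n%:Z) /=; last lia.
  rewrite ltnNge; apply/negP => Ln; apply: nL; move: ci; rewrite En {En}.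
  (* A column beyond [L] would by contiguity bring, one step at a time, a cell into the empty stack
     [i0 + L]. *)
  move: Ln => /subnK <-; elim: (n - L)%N => // k IH ci; apply: IH.
  have := columns_contiguous semi fst0 ci.
  by rewrite (_ : _ - 1 = i0 + (k + L)%N%:Z); [apply; lia|lia].
have L0 : (0 < L)%N.
  by case: L nL {minL colL ncolL} => //; rewrite addr0; case: fst0.
pose x0 := (f i0).1.
(* Lowering all columns by [x0] puts the first one at height 0, as a word requires. *)
pose g (k : nat) := shift (- x0) (f (i0 + k%:Z)).
have gwf k : (k < L)%N -> wf_shape m (g k).2 by move/colL/hf => [].
exists (mkseq g L), (i0, x0).
have ginC k c : (k < L)%N -> (c \in column P (i0 + k%:Z)) =
    ((c.1 - i0, c.2 - x0) \in colset k%:Z (g k)).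
  move=> kL; have [_ ->] := hf _ (colL _ kL).
  have := in_colset_shift c.1 (i0 + k%:Z) (- i0) (- x0) (f (i0 + k%:Z)) c.2.
  by rewrite -surjective_pairing (_ : i0 + k%:Z - i0 = k%:Z) //; lia.
split; last first.
  apply/fsetP => c; rewrite in_translate /=; apply/idP/idP.
    move=> cP; apply/in_cells_of; have cc : is_column P c.1.
      by apply/is_columnP; exists c.2; rewrite -surjective_pairing.
    have [k kL ck] := ncolL _ cc; exists k; rewrite ?size_mkseq // nth_mkseq //.
    by rewrite -ginC // in_column cP ck eqxx.
  move=> /in_cells_of[k]; rewrite size_mkseq => kL; rewrite nth_mkseq // -ginC // in_column.
  by case/andP.
have lnk k : (k.+1 < L)%N -> link (g k) (g k.+1).
  move=> kL; rewrite link_shift.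
  have [wk Ek] := hf _ (colL _ (ltnW kL)); have [wk1 Ek1] := hf _ (colL _ kL).
  apply/(link_components (i0 + k%:Z) wk wk1); rewrite -Ek.
  rewrite (_ : i0 + k%:Z + 1 = i0 + k.+1%:Z); last lia.
  rewrite -Ek1; apply: nxt; split; [exact: colL (ltnW kL)|exact: colL|lia|].
  by move=> l _; lia.
have g0 : (g 0).1 == 0 by rewrite /g addr0 /= subrr.
have gh : (g 0).2.1.2 == 0%N.
  have := hf _ fst0.1; have := conn0 _ fst0.
  rewrite /g /= addr0 => cc [wc E]; move: cc wc; rewrite E.
  case: (f i0) => x [[a h] b] cc wc /=.
  have /andP[a0 hb] := wc; rewrite eqn0Ngt; apply/negP => h0.
  move: hb; rewrite eqn0Ngt h0 /= => /andP[_ b0].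
  (* If the first column had a gap, the bottom cells of its two runs would not be linked. *)
  move/cells_connectedE: cc => /(_ (i0, x) (i0, x + a%:Z + h%:Z)).
  rewrite linked_colset //; last by rewrite eqn0Ngt h0.
  rewrite !in_colset /= !in_seg /= eqxx /= => H.
  have /= := H _ _; lia.
case: L L0 gwf lnk {nL minL colL ncolL ginC} => // L _ gwf lnk.
rewrite /mkseq /= g0 gh gwf //=.
apply/(pathP col0) => k; rewrite size_map size_iota => kL.
rewrite /next_col -[_ :: _]/(mkseq g L.+1) nth_mkseq ?leqW //.
rewrite (nth_map 0%N) ?size_iota // nth_iota // add1n.
by rewrite gwf // lnk.
Qed.

Lemma is_column_word (m : nat) (w : seq col) (i : int) : word m w ->
  is_column (cells_of w) i <-> exists2 k : nat, (k < size w)%N & i = k%:Z.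
Proof. by move=> /word_wf; apply: is_column_cells_of. Qed.

Lemma size_word_gt0 (m : nat) (w : seq col) : word m w -> (0 < size w)%N.
Proof. by case: w. Qed.

Lemma cells_of_column0 (m : nat) (w : seq col) (y : int) : word m w ->
  ((0, 0) \in cells_of w) && (((0, y) \in cells_of w) ==> (0 <= y)).
Proof.
move=> ww; have E (z : int) : ((0, z) \in cells_of w) = ((0, z) \in column (cells_of w) 0).
  by rewrite in_column /= eqxx andbT.
rewrite !E (column_cells_of (size_word_gt0 ww)).
case: w ww {E} => //= -[x [[a h] b]] s /and4P[/= /eqP-> /eqP-> wc _].
move: wc => /= /andP[a0 /eqP->]; rewrite !in_colset /=; lia.
Qed.

(** The normalisation of words forces the translation to be zero; after that the columns can be
    compared one by one. *)
Lemma cells_of_inj (m : nat) (w w' : seq col) (t : cell) :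
  word m w -> word m w' -> cells_of w' = translate t (cells_of w) -> w = w'.
Proof.
move=> ww ww' E.
have colE i : is_column (cells_of w') i <-> is_column (cells_of w) (i - t.1).
  rewrite !is_columnP E; split=> [[y yP]|[y yP]].
    by exists (y - t.2); move: yP; rewrite in_translate.
  by exists (y + t.2); rewrite in_translate /= addrK.
(* Both words occupy abscissae starting at 0, so neither can be moved sideways. *)
have t1 : t.1 = 0.
  have /colE/(is_column_word _ ww)[k _ ?] : is_column (cells_of w') 0.
    by apply/(is_column_word _ ww'); exists 0%N => //; apply: size_word_gt0 ww'.
  have : is_column (cells_of w') t.1.
    apply/colE/(is_column_word _ ww); exists 0%N; [exact: size_word_gt0 ww|lia].
  by move/(is_column_word _ ww') => [l _ ?]; lia.
(* In both sets the lowest cell of abscissa 0 has height 0. *)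
have t2 : t.2 = 0.
  have /andP[h1 _] := cells_of_column0 0 ww'.
  have /andP[_ h2] := cells_of_column0 (- t.2) ww.
  have /andP[h3 _] := cells_of_column0 0 ww.
  have /andP[_ h4] := cells_of_column0 (t.2) ww'.
  move: h1 h4 h2 h3; rewrite E !in_translate /= t1 !subrr !sub0r.
  by move=> -> /implyP h4 /= h2 h3; have := h4 h3; lia.
have {}E : cells_of w = cells_of w'.
  by rewrite E; apply/fsetP => c; rewrite in_translate t1 t2 !subr0 -surjective_pairing.
have sz : size w = size w'.
  wlog lt : w w' ww ww' E {colE t1 t2} / (size w < size w')%N.
    by move=> H; case: (ltngtP (size w) (size w')) => [/H|/H H'|//]; [apply|rewrite H'].
  have : is_column (cells_of w') (size w)%:Z by apply/(is_column_word _ ww'); exists (size w).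
  by rewrite -E => /(is_column_word _ ww)[k kw [ek]]; rewrite ek ltnn in kw.
apply: (eq_from_nth (x0 := col0)) => // k kw; apply: (@colset_inj m k).
- by have /all_nthP := word_wf ww; apply.
- by have /all_nthP := word_wf ww'; apply; rewrite -sz.
- by rewrite -!column_cells_of ?E // -sz.
Qed.

Lemma card_translate (t : cell) (P : {fset cell}) : #|` translate t P| = #|` P|.
Proof. by rewrite card_imfset //= => x y /addIr. Qed.

Lemma translation_class_translate (t : cell) (P : {fset cell}) :
  translation_class (translate t P) = translation_class P.
Proof.
have comp (s u : cell) Q : translate s (translate u Q) = translate (s + u : int * int) Q.
  apply/fsetP => c; rewrite !in_translate; congr (_ \in Q).
  by congr pair; rewrite /= opprD addrA.
apply/seteqP; split=> Q [s ->].
  by exists (s + t : int * int); rewrite comp.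
by exists (s - t : int * int); rewrite comp subrK.
Qed.

Lemma num_cheesy_words (m n : nat) (s : seq (seq col)) : uniq s ->
  (forall w, (w \in s) = word m w && (word_size w == n)) -> num_cheesy m n = size s.
Proof.
move=> us hs; pose g w := translation_class (cells_of w).
have ginj : {in s &, injective g}.
  move=> w w'; rewrite !hs => /andP[ww _] /andP[ww' _] E.
  have : g w (cells_of w').
    rewrite E; exists (0 : int * int); apply/fsetP => c.
    by rewrite in_translate !subr0 -surjective_pairing.
  by case=> t; apply: cells_of_inj ww ww'.
have E : cheesy_classes m n = [set` [fset x in map g s]].
  apply/seteqP; split=> [C [P [chP cP] <-]|C] /=.
    have [w [t [ww PE]]] := cheesy_word chP.
    rewrite PE translation_class_translate inE; apply: map_f.
    by rewrite hs ww -card_cells_of -cP PE card_translate eqxx.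
  rewrite inE => /mapP[w]; rewrite hs => /andP[ww /eqP wn] ->.
  exists (cells_of w) => //; split; first exact: word_cheesy ww.
  by rewrite card_cells_of.
rewrite /num_cheesy E set_fsetK card_imfset //= undup_id ?size_map //.
by rewrite map_inj_in_uniq.
Qed.

(** * Enumeration of words *)

(** The lower run of [t] must touch the hull of [s] placed at height 0, so its bottom lies between
    minus its length and the top of that hull; these finitely many candidates are filtered by
    [link]. *)
Definition offsets (s t : shape) : seq int :=
  [seq x <- [seq k%:Z - t.1.1%:Z | k <- iota 0 (t.1.1 + (s.1.1 + s.1.2 + s.2))]
     | link (0, s) (x, t)].

Lemma mem_offsets (s t : shape) (x : int) : (x \in offsets s t) = link (0, s) (x, t).
Proof.
rewrite mem_filter andb_idr // => H; apply/mapP; exists `|(x + t.1.1%:Z)%R|%N.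
  by rewrite mem_iota; case: s t H => [[a' h'] b'] [[a h] b] /=; lia.
by case: s t H => [[a' h'] b'] [[a h] b] /=; lia.
Qed.

Lemma offsets_uniq (s t : shape) : uniq (offsets s t).
Proof. by apply: filter_uniq; rewrite map_inj_uniq ?iota_uniq // => i j /addIr []. Qed.

Definition shapes (m l : nat) : seq shape :=
  (l, 0, 0)%N :: [seq (c, h, l - c)%N | c <- iota 1 l.-1, h <- iota 1 m].

Lemma mem_shapes (m l : nat) (t : shape) : (0 < l)%N ->
  (t \in shapes m l) = wf_shape m t && (shape_size t == l).
Proof.
move=> l0; case: t => [[a h] b]; rewrite inE /shape_size /=; apply/idP/idP.
  case/orP => [/eqP[-> -> ->]|/allpairsP[[c k] /= [+ + [-> -> ->]]]].
    by rewrite l0 /=; lia.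
  by rewrite !mem_iota; case: ifP; lia.
case/andP => /andP[a0]; case: ifP => [/eqP -> /eqP -> /eqP <-|h0 hb abl].
  by rewrite addn0 eqxx.
apply/orP; right; apply/allpairsP; exists (a, h); rewrite !mem_iota /=; split; try lia.
by congr (_, _); lia.
Qed.

Lemma shapes_uniq (m l : nat) : uniq (shapes m l).
Proof.
rewrite /= allpairs_uniq ?iota_uniq //; last by move=> [? ?] [? ?] _ _ /= [-> ->].
rewrite andbT; apply/negP => /allpairsP[[c h] /= [_ + [_ h0 _]]].
by rewrite -h0 mem_iota.
Qed.

Definition shapes_below (m n : nat) : seq shape :=
  [seq t | l <- iota 1 n.-1, t <- shapes m l].

Lemma mem_shapes_below (m n : nat) (t : shape) :
  (t \in shapes_below m n) = wf_shape m t && (shape_size t < n)%N.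
Proof.
apply/allpairsPdep/idP => [[l [t' [+ + ->]]]|/andP[wt tn]].
  rewrite mem_iota => ln; have l0 : (0 < l)%N by lia.
  by rewrite mem_shapes // => /andP[-> /eqP->]; lia.
have t0 : (0 < shape_size t)%N.
  by case: t wt {tn} => [[a h] b] /= /andP[]; rewrite /shape_size /=; lia.
by exists (shape_size t), t; rewrite mem_iota mem_shapes // wt eqxx; split=> //; lia.
Qed.

Lemma shapes_below_uniq (m n : nat) : uniq (shapes_below m n).
Proof.
apply: allpairs_uniq_dep; [exact: iota_uniq|by move=> l _; apply: shapes_uniq|].
move=> [l t] [l' t'] /allpairsPdep[k [u [+ + [-> ->]]]].
rewrite mem_iota => k0 + /allpairsPdep[k' [u' [+ + [-> ->]]]].
rewrite mem_iota => + k0' + /= E; subst u'.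
rewrite !mem_shapes; try lia.
by move=> /andP[_ /eqP<-] /andP[_ /eqP<-].
Qed.

Definition last_shape (w : seq col) : shape := (last col0 w).2.

Definition extend (p : shape * seq col) (x : int) : seq col :=
  rcons p.2 ((last col0 p.2).1 + x, p.1).

(** Words grow by a last column, whose shape governs the next extension. The fuel [f] bounds the
    number of columns; [f = n] suffices because every column has a cell. The list [iota n (0 < n)]
    is [[:: n]] for positive [n] and empty for [n = 0]. *)
Fixpoint words (m f n : nat) : seq (seq col) :=
  if f is f'.+1 then
    [seq [:: (0, (k, 0, 0)%N)] | k <- iota n (0 < n)] ++
    [seq extend p x
      | p <- [seq (t, w) | t <- shapes_below m n, w <- words m f' (n - shape_size t)],
        x <- offsets (last_shape p.2) p.1]
  else [::].

Lemma word_size_rcons (w : seq col) (c : col) :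
  word_size (rcons w c) = (word_size w + shape_size c.2)%N.
Proof. by rewrite /word_size map_rcons sumn_rcons. Qed.

Lemma word_rcons (m : nat) (w : seq col) (c : col) : (0 < size w)%N ->
  word m (rcons w c) = word m w && next_col m (last col0 w) c.
Proof. by case: w => //= d w _; rewrite rcons_path !andbA. Qed.

Lemma link_offsets (c' c : col) : link c' c = (c.1 - c'.1 \in offsets c'.2 c.2).
Proof.
by rewrite mem_offsets -(link_shift (- c'.1)) /shift subrr.
Qed.

Lemma wf_shape_size (m : nat) (t : shape) : wf_shape m t -> (0 < shape_size t)%N.
Proof. by case: t => [[a h] b] /= /andP[a0 _]; rewrite /shape_size addn_gt0 a0. Qed.

Lemma mem_words (m f n : nat) (w : seq col) :
  (w \in words m f n) = [&& word m w, word_size w == n & (size w <= f)%N].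
Proof.
elim: f n w => [|f IH] n w; first by case: w => // c s; rewrite /= !andbF.
rewrite mem_cat; apply/orP/and3P => [[/mapP[k +]|/allpairsPdep[[t u] [x [+ xo ->]]]]|].
- rewrite mem_iota => kn -> /=; split=> //; first by rewrite /word_size /shape_size /=; lia.
  by rewrite /word_size /shape_size /=; lia.
- move=> /allpairsPdep[t' [u' [+ + [E1 E2]]]]; subst t' u'.
  rewrite mem_shapes_below IH => /andP[wt tn] /and3P[wu /eqP un uf].
  rewrite word_rcons ?(size_word_gt0 wu) // wu /= word_size_rcons size_rcons un /=.
  split=> //; last by lia.
  by rewrite /next_col wt link_offsets /= addrAC subrr add0r.
- move=> [ww /eqP wn wf]; case/lastP: w ww wn wf => // w c.
  rewrite word_size_rcons size_rcons ltnS => ww wn wf.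
  have [w0|w0] := posnP (size w); [left|right].
    case: w w0 ww wn {wf} => //= _; case: c => x [[a h] b] /=.
    move=> /and4P[/eqP-> /eqP-> /andP[a0 /eqP->] _].
    rewrite /word_size /shape_size /= add0n addn0 => <-.
    by rewrite a0 inE.
  move: ww; rewrite word_rcons // => /andP[ww /andP[wc lk]].
  apply/allpairsPdep; exists (c.2, w), (c.1 - (last col0 w).1).
  rewrite -link_offsets; split=> //.
    apply/allpairsPdep; exists c.2, w; rewrite mem_shapes_below wc /=; split=> //.
      have : (0 < word_size w)%N; last by lia.
      case: w ww {wn wf w0 lk} => //= d w /and4P[_ _ /wf_shape_size d0 _].
      by rewrite /word_size /= addn_gt0 d0.
    by rewrite IH ww wf -wn addnK eqxx.
  by rewrite /extend /= addrC subrK -surjective_pairing.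
Qed.

Lemma words_uniq (m f n : nat) : uniq (words m f n).
Proof.
elim: f n => // f IH n; rewrite cat_uniq; apply/and3P; split.
- by rewrite map_inj_uniq ?iota_uniq // => k l [].
- apply/hasPn => _ /allpairsPdep[[t u] [x [+ _ ->]]].
  move=> /allpairsPdep[t' [u' [_ + [-> ->]]]]; rewrite mem_words => /and3P[uw _ _].
  apply/mapP => -[k _]; have := size_word_gt0 uw.
  by move=> + E; have := congr1 size E; rewrite size_rcons /= => -[->].
- apply: allpairs_uniq_dep.
  + apply: allpairs_uniq_dep; rewrite ?shapes_below_uniq // => -[t u] [t' u'] _ _ /=.
    by move=> [-> ->].
  + by move=> p _; apply: offsets_uniq.
  + move=> [[t u] x] [[t' u'] x'] _ _ /= /rcons_inj[-> + ->].
    by move/addrI ->.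
Qed.

Lemma word_size_ge (m : nat) (w : seq col) : word m w -> (size w <= word_size w)%N.
Proof.
move/word_wf; rewrite /word_size; elim: w => //= c w IH /andP[/wf_shape_size c0 /IH].
by lia.
Qed.

Lemma words_stable (m f n : nat) : (n <= f)%N -> perm_eq (words m f n) (words m n n).
Proof.
move=> nf; apply: uniq_perm; rewrite ?words_uniq // => w; rewrite !mem_words.
case: (boolP (word m w)) => //= /word_size_ge ww; case: eqP => //= E.
by rewrite -E in nf *; rewrite ww (leq_trans ww nf).
Qed.

Lemma num_cheesy_size_words (m n : nat) : num_cheesy m n = size (words m n n).
Proof.
apply: num_cheesy_words (words_uniq _ _ _) _ => w; rewrite mem_words.
case: (boolP (word m w)) => //= /word_size_ge ww; case: eqP => //= E.
by rewrite -E ww.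
Qed.

(** * Sums over words weighted by the last column *)

Definition wsum (m n : nat) (phi : shape -> int) : int :=
  \sum_(w <- words m n n) phi (last_shape w).

(** The last column [t] is removed. The number of its positions depends only on the shape [s] before
    it, so it becomes part of the weight of the shorter word; the isolated term is the word with one
    column. *)
Lemma wsum_rec (m n : nat) (phi : shape -> int) : (0 < n)%N ->
  wsum m n phi = phi (n, 0, 0)%N +
    \sum_(1 <= l < n) \sum_(t <- shapes m l)
       wsum m (n - l) (fun s => phi t * (size (offsets s t))%:Z).
Proof.
case: n => // n _; rewrite {1}/wsum [words m n.+1 n.+1]/= big_cons.
congr +%R; rewrite big_allpairs_dep /= big_allpairs_dep /= big_allpairs_dep /=.
rewrite /index_iota subSS subn0; apply: eq_big_seq => l; rewrite mem_iota => ln.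
apply: eq_big_seq => t; rewrite mem_shapes; last lia.
(* The shorter words carry more fuel than their size, which does not change the list up to order. *)
move=> /andP[_ /eqP ->]; rewrite (perm_big _ (words_stable _ (_ : n.+1 - l <= n)%N)) /=; last lia.
apply: eq_bigr => w _; rewrite (eq_bigr (fun _ => phi t)) => [|x _].
  by rewrite big_const_seq count_predT iter_addr addr0 -mulr_natr natz.
by rewrite /last_shape /extend last_rcons.
Qed.

(** * Counting the positions of a column *)

(** The admissible positions form an interval from which the exceptional positions [e] are
    removed. *)
Lemma size_offsets_interval (s t : shape) (lo : int) (n : nat) (e : seq int) :
  uniq e -> (forall x, x \in e -> lo <= x < lo + n%:Z) ->
  (forall x, link (0, s) (x, t) = (lo <= x < lo + n%:Z) && (x \notin e)) ->
  (size (offsets s t) + size e = n)%N.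
Proof.
move=> ue eI lI; rewrite -size_cat.
have -> : n = size [seq lo + k%:Z | k <- iota 0 n] by rewrite size_map size_iota.
apply: perm_size; apply: uniq_perm.
- rewrite cat_uniq offsets_uniq ue andbT; apply/hasPn => x xe.
  by rewrite /= mem_offsets lI xe andbF.
- by rewrite map_inj_uniq ?iota_uniq // => i j /addrI [].
- move=> x; rewrite mem_cat mem_offsets lI.
  transitivity (lo <= x < lo + n%:Z).
    by case: (boolP (x \in e)) => [/eI->|_]; rewrite ?orbT ?andbT ?orbF.
  apply/idP/mapP => [xI|[k]]; last by rewrite mem_iota => ? ->; lia.
  by exists `|(x - lo)%R|%N; [rewrite mem_iota; lia | lia].
Qed.

Lemma size_offsets_full (s t : shape) (lo : int) (n : nat) :
  (forall x : int, link (0, s) (x, t) = (lo <= x < lo + n%:Z)) -> size (offsets s t) = n.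
Proof.
move=> H; rewrite -(@size_offsets_interval s t lo n [::]) ?addn0 // => x.
by rewrite H andbT.
Qed.

Definition hull (t : shape) : int := (t.1.1 + t.1.2 + t.2)%N%:Z.
Definition one_cell (t : shape) : int := ((t.1.2 == 0%N) && (t.1.1 == 1%N))%:Z.
Definition gap2 (t : shape) : int := (t.1.2 == 2%N)%:Z.
Definition wide_lower (t : shape) : int := ((t.1.2 == 2%N) && (t.1.1 != 1%N))%:Z.
Definition wide_upper (t : shape) : int := ((t.1.2 == 2%N) && (t.2 != 1%N))%:Z.

(** A run of [a] cells touches [a + 1] consecutive heights, so within the hull of [s] it misses both
    runs only if it is a single cell facing a gap of two, which costs one position. *)
Lemma size_offsets_single (s : shape) (a : nat) : wf_shape 2 s -> (0 < a)%N ->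
  (size (offsets s (a, 0, 0)%N))%:Z = a%:Z + hull s - (a == 1%N)%:Z * gap2 s.
Proof.
case: s => [[a' h'] b']; rewrite /hull /gap2 /=.
move=> /andP[a'0 +] a0; case: h' => [|[|[|//]]] /= hb.
- by rewrite (@size_offsets_full _ _ (- a%:Z) (a + a')) => [|x /=]; lia.
- by rewrite (@size_offsets_full _ _ (- a%:Z) (a + a' + b' + 1)) => [|x /=]; lia.
- case: (a =P 1%N) => [a1|a1].
    have := @size_offsets_interval (a', 2, b')%N (a, 0, 0)%N (- a%:Z) (a + a' + b' + 2) [::
      a'%:Z] isT.
    move=> E; suff : (size (offsets (a', 2, b') (a, 0, 0)) + 1 = a + a' + b' + 2)%N by lia.
    by apply: E => x; rewrite !inE /=; lia.
  by rewrite (@size_offsets_full _ _ (- a%:Z) (a + a' + b' + 2)) => [|x /=]; lia.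
Qed.

(** The lower run bounds the position from below and the upper run from above, which leaves
    [hull s - 1] positions. Each run of a single cell loses the position where it faces a gap of
    two. *)
Lemma size_offsets_gap1 (s : shape) (a b : nat) : wf_shape 2 s -> (0 < a)%N -> (0 < b)%N ->
  (size (offsets s (a, 1, b)%N))%:Z =
    hull s - 1 - ((a == 1%N)%:Z + (b == 1%N)%:Z) * gap2 s.
Proof.
case: s => [[a' h'] b']; rewrite /hull /gap2 /=.
move=> /andP[a'0 +] a0 b0; case: h' => [|[|[|//]]] /= hb.
- by rewrite (@size_offsets_full _ _ (- a%:Z) a'.-1) => [|x /=]; lia.
- by rewrite (@size_offsets_full _ _ (- a%:Z) (a' + b')) => [|x /=]; lia.
- suff : (size (offsets (a', 2, b') (a, 1, b)) + ((a == 1) + (b == 1)) = a' + b' + 1)%N.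
    by lia.
  have E e := @size_offsets_interval (a', 2, b')%N (a, 1, b)%N (- a%:Z) (a' + b' + 1) e.
  case: (a =P 1%N) => a1; case: (b =P 1%N) => b1.
  + by apply: (E [:: a'%:Z; a'%:Z - a%:Z - 1]) => [|x|x]; rewrite /= !inE; lia.
  + by apply: (E [:: a'%:Z]) => [|x|x]; rewrite /= ?inE; lia.
  + by apply: (E [:: a'%:Z - a%:Z - 1]) => [|x|x]; rewrite /= ?inE; lia.
  + by apply: (E [::]) => [|x|x]; rewrite /= ?inE; lia.
Qed.

(** There are [hull s - 2] positions, except that a one-cell [s] gives 0 instead of -1, whence
    [one_cell s]. A lower run of one cell can face a gap of two, within the allowed interval, only
    if the upper run of [s] has at least two cells; the other run is symmetric. This is what
    [wide_upper] and [wide_lower] record. *)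
Lemma size_offsets_gap2 (s : shape) (a b : nat) : wf_shape 2 s -> (0 < a)%N -> (0 < b)%N ->
  (size (offsets s (a, 2, b)%N))%:Z = hull s - 2 + one_cell s
    - (a == 1%N)%:Z * wide_upper s - (b == 1%N)%:Z * wide_lower s.
Proof.
case: s => [[a' h'] b']; rewrite /hull /one_cell /wide_lower /wide_upper /=.
move=> /andP[a'0 +] a0 b0; case: h' => [|[|[|//]]] /= hb.
- by rewrite (@size_offsets_full _ _ (- a%:Z) (a' - 2)) => [|x /=]; lia.
- by rewrite (@size_offsets_full _ _ (- a%:Z) (a' + b' - 1)) => [|x /=]; lia.
- suff : (size (offsets (a', 2, b') (a, 2, b)) +
      ((a == 1) && (b' != 1) + (b == 1) && (a' != 1)) = a' + b')%N by lia.
  have E e := @size_offsets_interval (a', 2, b')%N (a, 2, b)%N (- a%:Z) (a' + b') e.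
  case ab: ((a == 1%N) && (b' != 1%N)); case ba: ((b == 1%N) && (a' != 1%N)).
  + by apply: (E [:: a'%:Z; a'%:Z - a%:Z - 2]) => [|x|x]; rewrite /= !inE; lia.
  + by apply: (E [:: a'%:Z]) => [|x|x]; rewrite /= ?inE; lia.
  + by apply: (E [:: a'%:Z - a%:Z - 2]) => [|x|x]; rewrite /= ?inE; lia.
  + by apply: (E [::]) => [|x|x]; rewrite /= ?inE; lia.
Qed.

Lemma eq_wsum (m n : nat) (phi psi : shape -> int) :
  (forall s, wf_shape m s -> phi s = psi s) -> wsum m n phi = wsum m n psi.
Proof.
move=> E; apply: eq_big_seq => w; rewrite mem_words => /andP[ww _]; apply: E.
have := word_wf ww; rewrite /last_shape; case: w ww => // c s _ /allP h.
by apply: (h (last c s)); apply: mem_last.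
Qed.

Lemma wsumD (m n : nat) (phi psi : shape -> int) :
  wsum m n (fun s => phi s + psi s) = wsum m n phi + wsum m n psi.
Proof. exact: big_split. Qed.

Lemma wsumZ (m n : nat) (c : int) (phi : shape -> int) :
  wsum m n (fun s => c * phi s) = c * wsum m n phi.
Proof. by rewrite /wsum mulr_sumr. Qed.

Definition total (n : nat) : int := wsum 2 n (fun _ => 1).
Definition total_hull (n : nat) : int := wsum 2 n hull.
Definition total_one (n : nat) : int := wsum 2 n one_cell.
Definition total_gap2 (n : nat) : int := wsum 2 n gap2.
(** Only the sum of the two weights enters the recursion, because the weights [phi] used there are
    symmetric under exchange of the runs. *)
Definition total_wide (n : nat) : int := wsum 2 n wide_lower + wsum 2 n wide_upper.

Lemma num_cheesy_total (n : nat) : (num_cheesy 2 n)%:Z = total n.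
Proof.
by rewrite num_cheesy_size_words /total /wsum big_const_seq count_predT iter_addr addr0 natz.
Qed.

Lemma wsum_single (n a : nat) (c : int) : (0 < a)%N ->
  wsum 2 n (fun s => c * (size (offsets s (a, 0, 0)%N))%:Z) =
  c * (a%:Z * total n + total_hull n - (a == 1%N)%:Z * total_gap2 n).
Proof.
move=> a0; rewrite wsumZ; congr (_ * _).
rewrite (@eq_wsum _ _ _ (fun s => a%:Z * 1 + hull s + - (a == 1%N)%:Z * gap2 s)).
  by rewrite !wsumD !wsumZ mulNr.
by move=> s ws; rewrite size_offsets_single // mulr1 mulNr.
Qed.

Lemma wsum_gap1 (n a b : nat) (c : int) : (0 < a)%N -> (0 < b)%N ->
  wsum 2 n (fun s => c * (size (offsets s (a, 1, b)%N))%:Z) =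
  c * (total_hull n - total n - ((a == 1%N)%:Z + (b == 1%N)%:Z) * total_gap2 n).
Proof.
move=> a0 b0; rewrite wsumZ; congr (_ * _).
rewrite (@eq_wsum _ _ _ (fun s => hull s + (-1) * 1 +
    - ((a == 1%N)%:Z + (b == 1%N)%:Z) * gap2 s)).
  by rewrite !wsumD !wsumZ -/(total n); ring.
by move=> s ws; rewrite size_offsets_gap1 // mulr1 mulNr.
Qed.

Lemma wsum_gap2 (n a b : nat) (c : int) : (0 < a)%N -> (0 < b)%N ->
  wsum 2 n (fun s => c * (size (offsets s (a, 2, b)%N))%:Z) =
  c * (total_hull n - 2 * total n + total_one n
       - (a == 1%N)%:Z * wsum 2 n wide_upper - (b == 1%N)%:Z * wsum 2 n wide_lower).
Proof.
move=> a0 b0; rewrite wsumZ; congr (_ * _).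
rewrite (@eq_wsum _ _ _ (fun s => hull s + (-2) * 1 + one_cell s +
    - (a == 1%N)%:Z * wide_upper s + - (b == 1%N)%:Z * wide_lower s)).
  by rewrite !wsumD !wsumZ -/(total n) -/(total_hull n) -/(total_one n); ring.
by move=> s ws; rewrite size_offsets_gap2 // mulr1 !mulNr.
Qed.

Lemma sum_shapes2 (l : nat) (F : shape -> int) :
  \sum_(t <- shapes 2 l) F t =
  F (l, 0, 0)%N + \sum_(1 <= c < l) (F (c, 1, l - c)%N + F (c, 2, l - c)%N).
Proof.
rewrite big_cons; congr (_ + _); rewrite big_allpairs_dep /= /index_iota subn1.
by apply: eq_bigr => c _; rewrite !big_cons big_nil addr0.
Qed.

Lemma sum_at_first (l : nat) (F : nat -> int) :
  \sum_(1 <= c < l) F c * (c == 1%N)%:Z = (1 < l)%:Z * F 1%N.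
Proof.
case: (ltnP 1 l) => l1; last by rewrite big_geq // mul0r.
rewrite big_ltn // eqxx mulr1 mul1r big_nat big1 ?addr0 // => c /andP[c1 _].
by rewrite (_ : (c == 1%N) = false) ?mulr0 //; lia.
Qed.

Lemma sum_at_last (l : nat) (F : nat -> int) :
  \sum_(1 <= c < l) F c * ((l - c)%N == 1%N)%:Z = (1 < l)%:Z * F l.-1.
Proof.
rewrite big_nat_rev /= -subn1 -(sum_at_first l (fun c => F (l - c)%N)).
rewrite !big_nat; apply: eq_bigr => c cl; congr (F _ * _).
all: lia.
Qed.

(** The position counts are substituted into [wsum_rec]. The corrections for one-cell runs come from
    the splits [c = 1] and [c = l - 1], which the symmetry of [phi] merges. *)
Lemma wsum2_rec (n : nat) (phi : shape -> int) : (0 < n)%N ->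
  (forall a h b, (0 < h)%N -> phi (a, h, b) = phi (b, h, a)) ->
  wsum 2 n phi = phi (n, 0, 0)%N + \sum_(1 <= l < n) (
    phi (l, 0, 0)%N * (l%:Z * total (n - l) + total_hull (n - l)
                       - (l == 1%N)%:Z * total_gap2 (n - l))
    + (\sum_(1 <= c < l) phi (c, 1, l - c)%N) * (total_hull (n - l) - total (n - l))
    + (\sum_(1 <= c < l) phi (c, 2, l - c)%N) *
        (total_hull (n - l) - 2 * total (n - l) + total_one (n - l))
    - (1 < l)%:Z * (2 * phi (1, 1, l.-1)%N * total_gap2 (n - l)
                    + phi (1, 2, l.-1)%N * total_wide (n - l))).
Proof.
move=> n0 sym; rewrite wsum_rec //; congr (_ + _).
rewrite [LHS]big_nat [RHS]big_nat; apply: eq_bigr => l /andP[l0 ln].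
rewrite sum_shapes2 wsum_single // -!addrA; congr (_ + _).
set j := (n - l)%N.
transitivity (\sum_(1 <= c < l) (
    (phi (c, 1, l - c)%N * (total_hull j - total j)
     + phi (c, 2, l - c)%N * (total_hull j - 2 * total j + total_one j))
    - ((phi (c, 1, l - c)%N * (c == 1%N)%:Z + phi (c, 1, l - c)%N * (l - c == 1)%N%:Z)
         * total_gap2 j
       + phi (c, 2, l - c)%N * (c == 1%N)%:Z * wsum 2 j wide_upper
       + phi (c, 2, l - c)%N * (l - c == 1)%N%:Z * wsum 2 j wide_lower))).
  rewrite !big_nat; apply: eq_bigr => c /andP[c0 cl].
  rewrite wsum_gap1 ?wsum_gap2 ?subn_gt0 //.
  by rewrite -/j; ring.
rewrite sumrB !big_split /= -!mulr_suml !big_split /=.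
rewrite !sum_at_first !sum_at_last /total_wide.
have [l1|l1] := ltnP 1 l; last by rewrite !mul0r; ring.
rewrite (_ : l - 1 = l.-1)%N ?subn1 // (_ : l - l.-1 = 1)%N; last lia.
by rewrite (sym l.-1 1%N 1%N isT) (sym l.-1 2%N 1%N isT); ring.
Qed.

(** * The linear recurrence *)

Definition conv (f x : nat -> int) (n : nat) : int :=
  \sum_(1 <= l < n) f l * x (n - l)%N.

Lemma convS (f x : nat -> int) (n : nat) : (0 < n)%N ->
  conv f x n.+1 = f 1%N * x n + conv (fun l => f l.+1) x n.
Proof.
by move=> n0; rewrite /conv big_ltn // subSS subn0 big_add1.
Qed.

Definition c0 : nat -> int := fun _ => 1.
Definition c1 : nat -> int := fun l => l%:Z.
Definition c2 : nat -> int := fun l => l%:Z * l%:Z.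

(** With the next two lemmas, the convolutions with 1, [l] and [l ^ 2] become state variables of a
    first-order recurrence, through the differences of these kernels:
    [(l + 1) ^ 2 = l ^ 2 + l + (l + 1)], and likewise in lower degree. *)
Lemma conv0S (x : nat -> int) (n : nat) : (0 < n)%N ->
  conv c0 x n.+1 = conv c0 x n + x n.
Proof. by move=> n0; rewrite convS // mul1r addrC. Qed.

Lemma conv1S (x : nat -> int) (n : nat) : (0 < n)%N ->
  conv c1 x n.+1 = conv c1 x n + conv c0 x n.+1.
Proof.
move=> n0; rewrite conv0S // convS // mul1r addrC addrA -big_split /=.
by congr (_ + _); apply: eq_bigr => l _; rewrite /c1 /c0; lia.
Qed.

Lemma conv2S (x : nat -> int) (n : nat) : (0 < n)%N ->
  conv c2 x n.+1 = conv c2 x n + conv c1 x n + conv c1 x n.+1.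
Proof.
move=> n0; rewrite conv1S // conv0S // convS // mul1r addrC !addrA -!big_split /=.
by congr (_ + _); apply: eq_bigr => l _; rewrite /c2 /c1 /c0; lia.
Qed.

Lemma conv_at1 (x : nat -> int) (n : nat) :
  conv (fun l => (l == 1%N)%:Z) x n.+2 = x n.+1.
Proof.
rewrite convS // mul1r /conv big1_seq ?addr0 // => l.
by rewrite mem_index_iota => /andP[_ l1]; rewrite (_ : _ == _ = false) ?mul0r //; lia.
Qed.

Lemma conv_at2 (x : nat -> int) (n : nat) : x 0%N = 0 ->
  conv (fun l => (l == 2%N)%:Z) x n.+2 = x n.
Proof.
move=> x0; rewrite convS // mul0r add0r; case: n => [|n]; last exact: conv_at1.
by rewrite /conv big_geq.
Qed.

Lemma wsum0 (phi : shape -> int) : wsum 2 0 phi = 0.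
Proof. by rewrite /wsum big_nil. Qed.

Lemma sum_const (l : nat) (x : int) : (0 < l)%N ->
  \sum_(1 <= c < l) x = (l%:Z - 1) * x.
Proof.
by move=> l0; rewrite sumr_const_nat -mulr_natl natz subzn.
Qed.

(** These combinations are the coefficients of the powers of [l] in the recursions. For [total],
    [seq_u] goes with [l] and [seq_v] with 1; for [total_hull], [seq_u] goes with [l ^ 2],
    [seq_u - seq_p] with [l] and [seq_w] with 1; [seq_g] serves the columns with a gap of two. *)
Definition seq_u (n : nat) : int := 2 * total_hull n - 2 * total n + total_one n.
Definition seq_v (n : nat) : int := 3 * total n - total_hull n - total_one n - 2 * total_gap2 n
  - total_wide n.
Definition seq_p (n : nat) : int := 2 * total_gap2 n + total_wide n.
Definition seq_w (n : nat) : int := 5 * total n - 3 * total_hull n - 2 * total_one n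
  - 2 * total_gap2 n - 2 * total_wide n.
Definition seq_g (n : nat) : int := total_hull n - 2 * total n + total_one n.
Definition at1 (l : nat) : int := (l == 1%N)%:Z.
Definition at2 (l : nat) : int := (l == 2%N)%:Z.

Lemma total_conv (n : nat) : (0 < n)%N ->
  total n = 1 + conv c1 seq_u n + conv c0 seq_v n
    + conv at1 total_gap2 n + conv at1 total_wide n.
Proof.
move=> n0; rewrite /total wsum2_rec // -!addrA; congr (_ + _).
rewrite -!big_split /=; apply: eq_big_nat => l /andP[l0 ln].
(* The corrections for one-cell runs require [l > 1]; extending them to [l = 1] leaves a term
   concentrated there, that is, a delay by one. *)
rewrite !sum_const // (_ : (1 < l)%:Z = 1 - at1 l); last by rewrite /at1; lia.
by rewrite -/(at1 l) /seq_u /seq_v /c1 /c0; ring.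
Qed.

Lemma total_hull_conv (n : nat) : (0 < n)%N ->
  total_hull n = n%:Z + conv c2 seq_u n + conv c1 seq_u n - conv c1 seq_p n
    + conv c0 seq_w n + 3 * conv at1 total_gap2 n + 3 * conv at1 total_wide n.
Proof.
move=> n0; rewrite /total_hull wsum2_rec //; last by move=> a h b _; rewrite /hull /=; lia.
rewrite {1}/hull /= !addn0 -!addrA; congr (_ + _).
rewrite /conv !mulr_sumr -sumrN -!big_split /=; apply: eq_big_nat => l /andP[l0 ln].
(* For fixed size [l] the hull of a two-run column is [l] plus its gap, however the cells are
   split. *)
rewrite (eq_big_nat _ _ (F2 := fun _ => l%:Z + 1)) => [|c cl]; last by rewrite /hull /=; lia.
rewrite (eq_big_nat _ _ (F1 := fun c => hull (c, 2, l - c)%N) (F2 := fun _ => l%:Z + 2))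
  => [|c cl]; last by rewrite /hull /=; lia.
rewrite !sum_const // (_ : (1 < l)%:Z = 1 - at1 l); last by rewrite /at1; lia.
rewrite -/(at1 l) /seq_u /seq_p /seq_w /c2 /c1 /c0 -/(total_hull (n - l)) /hull /= !addn0.
rewrite (_ : (1 + 1 + l.-1)%N%:Z = l%:Z + 1); last by lia.
rewrite (_ : (1 + 2 + l.-1)%N%:Z = l%:Z + 2); last by lia.
have [->|l1] := eqVneq l 1%N; first by rewrite /at1 /=; ring.
by rewrite (_ : at1 l = 0); [ring|rewrite /at1; lia].
Qed.

(** A last column of one cell follows a word of [n + 1] cells, so only the term [l = 1] survives. *)
Lemma total_one_rec (n : nat) :
  total_one n.+2 = total n.+1 + total_hull n.+1 - total_gap2 n.+1.
Proof.
rewrite /total_one wsum2_rec //; last by move=> a [|h] b.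
rewrite {1}/one_cell /= add0r big_ltn // subSS subn0 [X in _ + X]big1_seq => [|l].
  by rewrite addr0 [one_cell _]/= !big_geq // !mul0r mul1r !mul1r; ring.
rewrite mem_index_iota => /andP[_ l1]; rewrite !big1 // /one_cell /=.
by rewrite (_ : (l == 1%N) = false) ?mul0r ?mulr0; [ring|lia].
Qed.

Lemma total_gap2_conv (n : nat) : (0 < n)%N ->
  total_gap2 n = conv c1 seq_g n - conv c0 seq_g n - conv c0 total_wide n
    + conv at1 total_wide n.
Proof.
move=> n0; rewrite /total_gap2 wsum2_rec // {1}/gap2 /= add0r.
rewrite /conv -!sumrN -!big_split /=; apply: eq_big_nat => l /andP[l0 ln].
rewrite {1 2 3 4 5}/gap2 /= !sum_const // (_ : (1 < l)%:Z = 1 - at1 l); last by rewrite /at1; lia.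
by rewrite -/(at1 l) /seq_g /c1 /c0; ring.
Qed.

Lemma total_wide_conv (n : nat) : (0 < n)%N ->
  total_wide n = 2 * conv c1 seq_g n - 4 * conv c0 seq_g n + 2 * conv at1 seq_g n
    - conv c0 total_wide n + conv at1 total_wide n + conv at2 total_wide n.
Proof.
move=> n0; rewrite {1}/total_wide -wsumD wsum2_rec //; last first.
  by move=> a h b _; rewrite /wide_lower /wide_upper /= addrC.
rewrite {1}/wide_lower {1}/wide_upper /= add0r.
rewrite /conv !mulr_sumr -!sumrN -!big_split /=; apply: eq_big_nat => l /andP[l0 ln].
rewrite (eq_big_nat _ _ (F1 := fun c => wide_lower (c, 1, l - c)%N + wide_upper (c, 1, l - c)%N)
  (F2 := fun _ => 0)) // big1_eq.
(* A column with a gap of two contributes 2, less one for each of its runs that is a single cell. *)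
rewrite (eq_big_nat _ _ (F1 := fun c => wide_lower (c, 2, l - c)%N + wide_upper (c, 2, l - c)%N)
  (F2 := fun c => 2 + (-1 * (c == 1%N)%:Z + -1 * ((l - c)%N == 1%N)%:Z))) => [|c cl]; last first.
  by rewrite /wide_lower /wide_upper /=; lia.
rewrite /wide_lower /wide_upper /=.
rewrite !big_split /= sum_const // sum_at_first sum_at_last.
rewrite (_ : (1 < l)%:Z = 1 - at1 l); last by rewrite /at1; lia.
rewrite -/(at1 l) /seq_g /c1 /c0 !mul0r.
have [l1|l1] := eqVneq l 1%N; first by rewrite l1 /at1 /at2 /=; ring.
(* Both runs of the shape [(1, 2, l - 1)] are single cells exactly when [l = 2], which produces the
   delay by two. *)
rewrite (_ : (l.-1 != 1%N)%:Z = 1 - at2 l); last by rewrite /at2; lia.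
by rewrite (_ : at1 l = 0); [ring|rewrite /at1; lia].
Qed.

(* T, Y, O, Q, H stand for total, total_hull, total_one, total_gap2, total_wide
   from n = 2 on; a letter followed by a digit r is a convolution with l ^ r, and
   Xp, Xpp are X delayed by one and two steps. *)
Definition linear_system (T Y O Q H u0 u1 u2 v0 p0 p1 w0 g0 g1 h0 Qp Hp Gp Hpp N : nat -> int)
  : Prop :=
  forall n,
  [/\ [/\ T n = 1 + u1 n + v0 n + Qp n + Hp n,
      Y n = N n + u2 n + u1 n - p1 n + w0 n + 3 * Qp n + 3 * Hp n,
      Q n = g1 n - g0 n - h0 n + Hp n,
      H n = 2 * g1 n - 4 * g0 n + 2 * Gp n - h0 n + Hp n + Hpp n &
      O n.+1 = T n + Y n - Q n],
    [/\ u0 n.+1 = u0 n + (2 * Y n - 2 * T n + O n),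
      u1 n.+1 = u1 n + u0 n.+1,
      u2 n.+1 = u2 n + u1 n + u1 n.+1,
      v0 n.+1 = v0 n + (3 * T n - Y n - O n - 2 * Q n - H n) &
      p0 n.+1 = p0 n + (2 * Q n + H n)],
    [/\ p1 n.+1 = p1 n + p0 n.+1,
      w0 n.+1 = w0 n + (5 * T n - 3 * Y n - 2 * O n - 2 * Q n - 2 * H n),
      g0 n.+1 = g0 n + (Y n - 2 * T n + O n),
      g1 n.+1 = g1 n + g0 n.+1 &
      h0 n.+1 = h0 n + H n] &
    [/\ Qp n.+1 = Q n, Hp n.+1 = H n, Hpp n.+1 = Hp n,
      Gp n.+1 = Y n - 2 * T n + O n & N n.+1 = N n + 1]].

(** The recurrence is a linear consequence of twelve consecutive instances of the system, from which
    all the auxiliary sequences are eliminated. *)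
Lemma linear_system_elim T Y O Q H u0 u1 u2 v0 p0 p1 w0 g0 g1 h0 Qp Hp Gp Hpp N :
  linear_system T Y O Q H u0 u1 u2 v0 p0 p1 w0 g0 g1 h0 Qp Hp Gp Hpp N ->
  forall n, T n.+4.+4.+3 = 9 * T n.+4.+4.+2 - 27 * T n.+4.+4.+1 + 31 * T n.+4.+4
    - 8 * T n.+4.+3 - 4 * T n.+4.+2 + 2 * T n.+4.+1 - 16 * T n.+4 + 5 * T n.+3
    + 16 * T n.+2 + 2 * T n.+1 - 5 * T n.
Proof.
move=> st n.
have [[? ? ? ? ?] [? ? ? ? ?] [? ? ? ? ?] [? ? ? ? ?]] := st n.
have [[? ? ? ? ?] [? ? ? ? ?] [? ? ? ? ?] [? ? ? ? ?]] := st n.+1.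
have [[? ? ? ? ?] [? ? ? ? ?] [? ? ? ? ?] [? ? ? ? ?]] := st n.+2.
have [[? ? ? ? ?] [? ? ? ? ?] [? ? ? ? ?] [? ? ? ? ?]] := st n.+3.
have [[? ? ? ? ?] [? ? ? ? ?] [? ? ? ? ?] [? ? ? ? ?]] := st n.+4.
have [[? ? ? ? ?] [? ? ? ? ?] [? ? ? ? ?] [? ? ? ? ?]] := st n.+4.+1.
have [[? ? ? ? ?] [? ? ? ? ?] [? ? ? ? ?] [? ? ? ? ?]] := st n.+4.+2.
have [[? ? ? ? ?] [? ? ? ? ?] [? ? ? ? ?] [? ? ? ? ?]] := st n.+4.+3.
have [[? ? ? ? ?] [? ? ? ? ?] [? ? ? ? ?] [? ? ? ? ?]] := st n.+4.+4.
have [[? ? ? ? ?] [? ? ? ? ?] [? ? ? ? ?] [? ? ? ? ?]] := st n.+4.+4.+1.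
have [[? ? ? ? ?] [? ? ? ? ?] [? ? ? ? ?] [? ? ? ? ?]] := st n.+4.+4.+2.
have [[? ? ? ? ?] [? ? ? ? ?] [? ? ? ? ?] [? ? ? ? ?]] := st n.+4.+4.+3.
by clear st; lia.
Qed.

(* Literals of type int are unary, hence the splitting of the large ones. *)
Lemma linear_system_values T Y O Q H u0 u1 u2 v0 p0 p1 w0 g0 g1 h0 Qp Hp Gp Hpp N :
  linear_system T Y O Q H u0 u1 u2 v0 p0 p1 w0 g0 g1 h0 Qp Hp Gp Hpp N ->
  [/\ u0 0%N = 1, u1 0%N = 1, u2 0%N = 1, v0 0%N = 1 & p0 0%N = 0] ->
  [/\ p1 0%N = 0, w0 0%N = 0, g0 0%N = 0, g1 0%N = 0 & h0 0%N = 0] ->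
  [/\ Qp 0%N = 0, Hp 0%N = 0, Gp 0%N = 0, Hpp 0%N = 0 & O 0%N = 2 /\ N 0%N = 2] ->
  [/\ T 0%N = 3, T 1%N = 11, T 2%N = 43, T 3%N = 174 & T 4%N = 718] /\
  [/\ T 5%N = 2 * 1000 + 996, T 6%N = 12 * 1000 + 579, T 7%N = 52 * 1000 + 996, T 8%N = 223 *
    1000 + 705 & T 9%N = 945 * 1000 + 324 /\ T 10%N = (3 * 1000 + 997) * 1000 + 185].
Proof.
move=> st [? ? ? ? ?] [? ? ? ? ?] [? ? ? ? [? ?]].
have [[? ? ? ? ?] [? ? ? ? ?] [? ? ? ? ?] [? ? ? ? ?]] := st 0%N.
have [[? ? ? ? ?] [? ? ? ? ?] [? ? ? ? ?] [? ? ? ? ?]] := st 1%N.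
have [[? ? ? ? ?] [? ? ? ? ?] [? ? ? ? ?] [? ? ? ? ?]] := st 2%N.
have [[? ? ? ? ?] [? ? ? ? ?] [? ? ? ? ?] [? ? ? ? ?]] := st 3%N.
have [[? ? ? ? ?] [? ? ? ? ?] [? ? ? ? ?] [? ? ? ? ?]] := st 4%N.
have [[? ? ? ? ?] [? ? ? ? ?] [? ? ? ? ?] [? ? ? ? ?]] := st 5%N.
have [[? ? ? ? ?] [? ? ? ? ?] [? ? ? ? ?] [? ? ? ? ?]] := st 6%N.
have [[? ? ? ? ?] [? ? ? ? ?] [? ? ? ? ?] [? ? ? ? ?]] := st 7%N.
have [[? ? ? ? ?] [? ? ? ? ?] [? ? ? ? ?] [? ? ? ? ?]] := st 8%N.
have [[? ? ? ? ?] [? ? ? ? ?] [? ? ? ? ?] [? ? ? ? ?]] := st 9%N.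
have [[? ? ? ? ?] [? ? ? ? ?] [? ? ? ? ?] [? ? ? ? ?]] := st 10%N.
by clear st; do 2 split; lia.
Qed.

Lemma total_linear_system :
  linear_system (fun n => total n.+2) (fun n => total_hull n.+2)
  (fun n => total_one n.+2) (fun n => total_gap2 n.+2) (fun n => total_wide n.+2)
  (fun n => conv c0 seq_u n.+2) (fun n => conv c1 seq_u n.+2) (fun n => conv c2 seq_u n.+2)
  (fun n => conv c0 seq_v n.+2)
  (fun n => conv c0 seq_p n.+2) (fun n => conv c1 seq_p n.+2)
  (fun n => conv c0 seq_w n.+2)
  (fun n => conv c0 seq_g n.+2) (fun n => conv c1 seq_g n.+2)
  (fun n => conv c0 total_wide n.+2)
  (fun n => total_gap2 n.+1) (fun n => total_wide n.+1) (fun n => seq_g n.+1) total_wide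
  (fun n => n.+2%:Z).
Proof.
move=> n.
split; split=> //.
- by rewrite {1}total_conv // !conv_at1.
- by rewrite {1}total_hull_conv // !conv_at1.
- by rewrite {1}total_gap2_conv // !conv_at1.
- by rewrite {1}total_wide_conv // !conv_at1 conv_at2 // /total_wide !wsum0.
- exact: total_one_rec.
- exact: conv0S.
- exact: conv1S.
- exact: conv2S.
- exact: conv0S.
- exact: conv0S.
- exact: conv1S.
- exact: conv0S.
- exact: conv0S.
- exact: conv1S.
- exact: conv0S.
- by rewrite -[n.+3]addn1.
Qed.

Lemma total_rec (n : nat) :
  let k i := total (n + i)%N in
  k 13%N = 9 * k 12%N - 27 * k 11%N + 31 * k 10%N - 8 * k 9%N - 4 * k 8%N + 2 * k 7%N
    - 16 * k 6%N + 5 * k 5%N + 16 * k 4%N + 2 * k 3%N - 5 * k 2%N.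
Proof.
rewrite /= !addnS !addn0; exact: linear_system_elim total_linear_system n.
Qed.

Lemma wsum1 (phi : shape -> int) : wsum 2 1 phi = phi (1, 0, 0)%N.
Proof. by rewrite /wsum /= big_cons big_nil addr0. Qed.

Lemma conv_2 (f x : nat -> int) : conv f x 2 = f 1%N * x 1%N.
Proof. by rewrite convS // [conv _ _ _]big_geq // addr0. Qed.

Lemma total_values :
  [/\ total 2 = 3, total 3 = 11, total 4 = 43, total 5 = 174 & total 6 = 718] /\
  [/\ total 7 = 2 * 1000 + 996, total 8 = 12 * 1000 + 579, total 9 = 52 * 1000 + 996, total 10
    = 223 * 1000 + 705
    & total 11 = 945 * 1000 + 324 /\ total 12 = (3 * 1000 + 997) * 1000 + 185].
Proof.
(* All initial data reduce to sums over words of zero or one cell. *)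
apply: (linear_system_values total_linear_system);
  by split; rewrite ?conv_2 ?total_one_rec /seq_u /seq_v /seq_p /seq_w /seq_g /total
    /total_hull /total_one
    /total_gap2 /total_wide ?wsum1 ?wsum0.
Qed.

(** * The dominant root *)

(** The inequality on [d] makes [rho ^+ n] a supersolution of the recurrence in absolute values, so
    a bound on the first [N] terms propagates by strong induction. *)
Lemma recurrence_bound (R : realFieldType) (N : nat) (d : 'I_N -> R) (rho : R)
    (u : nat -> R) :
  0 < rho -> \sum_(i < N) `|d i| * rho ^+ i <= rho ^+ N ->
  (forall n, u (n + N)%N = \sum_(i < N) d i * u (n + i)%N) ->
  exists C, forall n, `|u n| <= C * rho ^+ n.
Proof.
(* [C] dominates each of the first [N] ratios, since each is one of its nonnegative summands. *)
move=> r0 dr rec; pose C := \sum_(i < N) `|u i| / rho ^+ i.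
have C0 : 0 <= C by apply: sumr_ge0 => i _; rewrite divr_ge0 // exprn_ge0 // ltW.
exists C => n; elim/ltn_ind: n => n IH; have [nN|Nn] := ltnP n N.
  rewrite -ler_pdivrMr ?exprn_gt0 // /C (bigD1 (Ordinal nN)) //= lerDl.
  by apply: sumr_ge0 => i _; rewrite divr_ge0 // exprn_ge0 // ltW.
rewrite -(subnK Nn) rec; apply: le_trans (ler_norm_sum _ _ _) _.
apply: (@le_trans _ _ (C * rho ^+ (n - N) * \sum_(i < N) `|d i| * rho ^+ i)).
  rewrite mulr_sumr; apply: ler_sum => i _; rewrite normrM.
  rewrite [leRHS]mulrC -!mulrA; apply: ler_wpM2l; first exact: normr_ge0.
  apply: le_trans (IH _ _) _; first by have := ltn_ord i; lia.
  by rewrite exprD le_eqVlt; apply/orP; left; apply/eqP; ring.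
rewrite exprD mulrA; apply: ler_wpM2l => //.
by rewrite mulr_ge0 // exprn_ge0 // ltW.
Qed.

Lemma cvg_geometric_bound (R : realType) (u : nat -> R) (C rho lam : R) :
  0 < rho < lam -> (forall n, `|u n| <= C * rho ^+ n) ->
  (fun n => u n / lam ^+ n) @ \oo --> (0 : R).
Proof.
move=> /andP[r0 rl] uC; have l0 : 0 < lam by apply: lt_trans rl.
apply/norm_cvg0P.
apply: (@squeeze_cvgr _ _ _ _ (fun=> 0) (fun n => C * (rho / lam) ^+ n)).
- apply: nearW => n; rewrite normr_ge0 /= normrM normfV (ger0_norm (exprn_ge0 _ (ltW l0))).
  by rewrite expr_div_n mulrA ler_pM2r ?invr_gt0 ?exprn_gt0.
- exact: cvg_cst.
- rewrite -[X in _ --> X](mulr0 C); apply: cvgM; first exact: cvg_cst.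
  apply: cvg_expr; rewrite ger0_norm ?divr_ge0 ?(ltW r0) ?(ltW l0) //.
  by rewrite ltr_pdivrMr // mul1r.
Qed.

(** * Interval arithmetic and synthetic division *)

Lemma mul_enclosure_pos (R : realDomainType) (l x h lo y hi : R) :
  0 <= l -> 0 <= lo -> l <= x <= h -> lo <= y <= hi -> lo * l <= y * x <= hi * h.
Proof.
move=> l0 lo0 /andP[lx xh] /andP[ly yh].
by rewrite !ler_pM // ?(le_trans l0 lx) ?(le_trans lo0 ly).
Qed.

Lemma mul_enclosure_neg (R : realDomainType) (l x h lo y hi : R) :
  0 <= l -> hi <= 0 -> l <= x <= h -> lo <= y <= hi -> lo * h <= y * x <= hi * l.
Proof.
move=> l0 hi0 lx /andP[ly yh].
have /andP[] : - hi * l <= - y * x <= - lo * h.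
  by apply: mul_enclosure_pos; rewrite ?oppr_ge0 ?lerN2 ?ly ?yh.
by rewrite !mulNr !lerN2 => -> ->.
Qed.

(** One Horner step in interval arithmetic, with room for outward rounding in [lo2] and [hi2]. As
    [x] is nonnegative, the sign of [y] decides which ends are multiplied; the other sign is treated
    next. *)
Lemma enclosure_step_pos (R : realDomainType) (l x h lo y hi clo c chi lo2 hi2 : R) :
  0 <= l -> l <= x <= h -> lo <= y <= hi -> clo <= c <= chi ->
  [/\ 0 <= lo, lo2 <= lo * l + clo & hi * h + chi <= hi2] -> lo2 <= y * x + c <= hi2.
Proof.
move=> l0 xI yI /andP[c1 c2] [lo0 h1 h2].
have /andP[p1 p2] := mul_enclosure_pos l0 lo0 xI yI.
by rewrite (le_trans h1 (lerD p1 c1)) (le_trans (lerD p2 c2) h2).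
Qed.

Lemma enclosure_step_neg (R : realDomainType) (l x h lo y hi clo c chi lo2 hi2 : R) :
  0 <= l -> l <= x <= h -> lo <= y <= hi -> clo <= c <= chi ->
  [/\ hi <= 0, lo2 <= lo * h + clo & hi * l + chi <= hi2] -> lo2 <= y * x + c <= hi2.
Proof.
move=> l0 xI yI /andP[c1 c2] [hi0 h1 h2].
have /andP[p1 p2] := mul_enclosure_neg l0 hi0 xI yI.
by rewrite (le_trans h1 (lerD p1 c1)) (le_trans (lerD p2 c2) h2).
Qed.

(** The coefficients of chi, leading one first. *)
Definition char_coef (R : pzRingType) (i : nat) : R :=
  nth 0 [:: 1; -9; 27; -31; 8; 4; -2; 16; -5; -16; -2; 5] i.

Fixpoint horner_sums (R : pzRingType) (c : nat -> R) (x : R) (i : nat) : R :=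
  if i is j.+1 then horner_sums c x j * x + c i else c 0%N.

(** Division by [X - x], with [f i] in place of the power of [X] of exponent [m - i]: the Horner
    sums are the coefficients of the quotient, and the last one is the remainder. *)
Lemma synthetic_division (R : comPzRingType) (c : nat -> R) (x : R) (f : nat -> R) (m : nat) :
  \sum_(i < m) horner_sums c x i * (f i - x * f i.+1) =
  \sum_(i < m.+1) c i * f i - horner_sums c x m * f m.
Proof.
elim: m => [|m IH]; first by rewrite big_ord0 big_ord_recr big_ord0 /= add0r subrr.
by rewrite big_ord_recr /= IH [in RHS]big_ord_recr /=; ring.
Qed.

(** For [i < 11] these are the coefficients of q, and [quot x 11] is chi(x). Dividing once more,
    [quot2 x 10] is q(x), which equals chi'(x). *)
Definition quot (R : pzRingType) (x : R) : nat -> R := horner_sums (char_coef R) x.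
Definition quot2 (R : pzRingType) (x : R) : nat -> R := horner_sums (quot x) x.

Lemma dominant_root (R : realType) : exists2 x : R,
  4 + 231 / 10 ^+ 3 + 836 / 10 ^+ 6 + 358 / 10 ^+ 9 <= x <= 4 + 231 / 10 ^+ 3 + 836 / 10 ^+ 6 +
    359 / 10 ^+ 9 & quot x 11 = 0.
Proof.
(* [Poly] expects the constant term first, hence the reversal. *)
pose p : {poly R} := Poly (rev [seq char_coef R i | i <- iota 0 12]).
have pE x : p.[x] = quot x 11 by rewrite horner_Poly /quot /char_coef /=; ring.
have [||x xI /rootP] := @poly_ivt _ p (4 + 231 / 10 ^+ 3 + 836 / 10 ^+ 6 + 358 / 10 ^+ 9) (4 +
  231 / 10 ^+ 3 + 836 / 10 ^+ 6 + 359 / 10 ^+ 9); first by lra.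
  by rewrite !pE /quot /char_coef /=; apply/andP; split; lra.
by rewrite pE => x0; exists x.
Qed.

(** Each Horner step multiplies the width of the enclosure by about [x], so the root is taken to
    nine decimals and the bounds are kept to eight. *)
Lemma quot_enclosure (R : realFieldType) (x : R) :
  4 + 231 / 10 ^+ 3 + 836 / 10 ^+ 6 + 358 / 10 ^+ 9 <= x <= 4 + 231 / 10 ^+ 3 + 836 / 10 ^+ 6 +
    359 / 10 ^+ 9 ->
  [/\ - (4 + 768 / 10 ^+ 3 + 163 / 10 ^+ 6 + 65 / 10 ^+ 8) <= quot x 1 <= - (4 + 768 / 10 ^+ 3
    + 163 / 10 ^+ 6 + 64 / 10 ^+ 8),
    6 + 821 / 10 ^+ 3 + 911 / 10 ^+ 6 + 70 / 10 ^+ 8 <= quot x 2 <= 6 + 821 / 10 ^+ 3 + 911 /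
      10 ^+ 6 + 75 / 10 ^+ 8,
    - (2 + 130 / 10 ^+ 3 + 786 / 10 ^+ 6 + 4 / 10 ^+ 8) <= quot x 3 <= - (2 + 130 / 10 ^+ 3 +
      785 / 10 ^+ 6 + 81 / 10 ^+ 8),
    - (1 + 17 / 10 ^+ 3 + 137 / 10 ^+ 6 + 84 / 10 ^+ 8) <= quot x 4 <= - (1 + 17 / 10 ^+ 3 +
      136 / 10 ^+ 6 + 86 / 10 ^+ 8) &
    - (304 / 10 ^+ 3 + 360 / 10 ^+ 6 + 90 / 10 ^+ 8) <= quot x 5 <= - (304 / 10 ^+ 3 + 356 / 10
      ^+ 6 + 74 / 10 ^+ 8)] /\
  [/\ - (3 + 288 / 10 ^+ 3 + 5 / 10 ^+ 6 + 53 / 10 ^+ 8) <= quot x 6 <= - (3 + 287 / 10 ^+ 3 +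
    987 / 10 ^+ 6 + 91 / 10 ^+ 8),
    2 + 85 / 10 ^+ 3 + 698 / 10 ^+ 6 + 64 / 10 ^+ 8 <= quot x 7 <= 2 + 85 / 10 ^+ 3 + 773 / 10
      ^+ 6 + 22 / 10 ^+ 8,
    3 + 826 / 10 ^+ 3 + 335 / 10 ^+ 6 + 33 / 10 ^+ 8 <= quot x 8 <= 3 + 826 / 10 ^+ 3 + 650 /
      10 ^+ 6 + 95 / 10 ^+ 8,
    192 / 10 ^+ 3 + 424 / 10 ^+ 6 + 96 / 10 ^+ 8 <= quot x 9 <= 193 / 10 ^+ 3 + 760 / 10 ^+ 6 +
      63 / 10 ^+ 8 &
    - (1 + 185 / 10 ^+ 3 + 689 / 10 ^+ 6 + 6 / 10 ^+ 8) <= quot x 10 <= - (1 + 180 / 10 ^+ 3 +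
      36 / 10 ^+ 6 + 72 / 10 ^+ 8)].
Proof.
move=> x_bounds.
have x0 : 0 <= 4 + 231 / 10 ^+ 3 + 836 / 10 ^+ 6 + 358 / 10 ^+ 9 :> R by lra.
have CI (c : R) : c <= c <= c by rewrite lexx.
have B0 : 1 <= quot x 0 <= 1 by rewrite /quot /char_coef /=; lra.
have B1 : - (4 + 768 / 10 ^+ 3 + 163 / 10 ^+ 6 + 65 / 10 ^+ 8) <= quot x 1 <= - (4 + 768 / 10
  ^+ 3 + 163 / 10 ^+ 6 + 64 / 10 ^+ 8).
  rewrite -[quot x 1]/(quot x 0 * x + -9).
  by apply: (enclosure_step_pos x0 x_bounds B0 (CI (-9))); clear; split; lra.
have B2 : 6 + 821 / 10 ^+ 3 + 911 / 10 ^+ 6 + 70 / 10 ^+ 8 <= quot x 2 <= 6 + 821 / 10 ^+ 3 +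
  911 / 10 ^+ 6 + 75 / 10 ^+ 8.
  rewrite -[quot x 2]/(quot x 1 * x + 27).
  by apply: (enclosure_step_neg x0 x_bounds B1 (CI (27))); clear; split; lra.
have B3 : - (2 + 130 / 10 ^+ 3 + 786 / 10 ^+ 6 + 4 / 10 ^+ 8) <= quot x 3 <= - (2 + 130 / 10 ^+
  3 + 785 / 10 ^+ 6 + 81 / 10 ^+ 8).
  rewrite -[quot x 3]/(quot x 2 * x + -31).
  by apply: (enclosure_step_pos x0 x_bounds B2 (CI (-31))); clear; split; lra.
have B4 : - (1 + 17 / 10 ^+ 3 + 137 / 10 ^+ 6 + 84 / 10 ^+ 8) <= quot x 4 <= - (1 + 17 / 10 ^+
  3 + 136 / 10 ^+ 6 + 86 / 10 ^+ 8).
  rewrite -[quot x 4]/(quot x 3 * x + 8).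
  by apply: (enclosure_step_neg x0 x_bounds B3 (CI (8))); clear; split; lra.
have B5 : - (304 / 10 ^+ 3 + 360 / 10 ^+ 6 + 90 / 10 ^+ 8) <= quot x 5 <= - (304 / 10 ^+ 3 +
  356 / 10 ^+ 6 + 74 / 10 ^+ 8).
  rewrite -[quot x 5]/(quot x 4 * x + 4).
  by apply: (enclosure_step_neg x0 x_bounds B4 (CI (4))); clear; split; lra.
have B6 : - (3 + 288 / 10 ^+ 3 + 5 / 10 ^+ 6 + 53 / 10 ^+ 8) <= quot x 6 <= - (3 + 287 / 10 ^+
  3 + 987 / 10 ^+ 6 + 91 / 10 ^+ 8).
  rewrite -[quot x 6]/(quot x 5 * x + -2).
  by apply: (enclosure_step_neg x0 x_bounds B5 (CI (-2))); clear; split; lra.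
have B7 : 2 + 85 / 10 ^+ 3 + 698 / 10 ^+ 6 + 64 / 10 ^+ 8 <= quot x 7 <= 2 + 85 / 10 ^+ 3 + 773
  / 10 ^+ 6 + 22 / 10 ^+ 8.
  rewrite -[quot x 7]/(quot x 6 * x + 16).
  by apply: (enclosure_step_neg x0 x_bounds B6 (CI (16))); clear; split; lra.
have B8 : 3 + 826 / 10 ^+ 3 + 335 / 10 ^+ 6 + 33 / 10 ^+ 8 <= quot x 8 <= 3 + 826 / 10 ^+ 3 +
  650 / 10 ^+ 6 + 95 / 10 ^+ 8.
  rewrite -[quot x 8]/(quot x 7 * x + -5).
  by apply: (enclosure_step_pos x0 x_bounds B7 (CI (-5))); clear; split; lra.
have B9 : 192 / 10 ^+ 3 + 424 / 10 ^+ 6 + 96 / 10 ^+ 8 <= quot x 9 <= 193 / 10 ^+ 3 + 760 / 10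
  ^+ 6 + 63 / 10 ^+ 8.
  rewrite -[quot x 9]/(quot x 8 * x + -16).
  by apply: (enclosure_step_pos x0 x_bounds B8 (CI (-16))); clear; split; lra.
have B10 : - (1 + 185 / 10 ^+ 3 + 689 / 10 ^+ 6 + 6 / 10 ^+ 8) <= quot x 10 <= - (1 + 180 / 10
  ^+ 3 + 36 / 10 ^+ 6 + 72 / 10 ^+ 8).
  rewrite -[quot x 10]/(quot x 9 * x + -2).
  by apply: (enclosure_step_pos x0 x_bounds B9 (CI (-2))); clear; split; lra.
by do !split.
Qed.

Lemma quot2_enclosure (R : realFieldType) (x : R) :
  4 + 231 / 10 ^+ 3 + 836 / 10 ^+ 6 + 358 / 10 ^+ 9 <= x <= 4 + 231 / 10 ^+ 3 + 836 / 10 ^+ 6 +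
    359 / 10 ^+ 9 ->
  0 < quot2 x 9 /\ (409 * 1000 + 356) + 116 / 10 ^+ 3 + 952 / 10 ^+ 6 + 35 / 10 ^+ 8 <= quot2 x
    10 <= (409 * 1000 + 356) + 177 / 10 ^+ 3 + 649 / 10 ^+ 6 + 12 / 10 ^+ 8.
Proof.
move=> x_bounds.
have x0 : 0 <= 4 + 231 / 10 ^+ 3 + 836 / 10 ^+ 6 + 358 / 10 ^+ 9 :> R by lra.
have B0 : 1 <= quot2 x 0 <= 1 by rewrite /quot2 /quot /char_coef /=; lra.
have [[C1 C2 C3 C4 C5] [C6 C7 C8 C9 C10]] := quot_enclosure x_bounds.
have B1 : - (536 / 10 ^+ 3 + 327 / 10 ^+ 6 + 30 / 10 ^+ 8) <= quot2 x 1 <= - (536 / 10 ^+ 3 +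
  327 / 10 ^+ 6 + 28 / 10 ^+ 8).
  rewrite -[quot2 x 1]/(quot2 x 0 * x + quot x 1).
  by apply: (enclosure_step_pos x0 x_bounds B0 C1); clear; split; lra.
have B2 : 4 + 552 / 10 ^+ 3 + 262 / 10 ^+ 6 + 33 / 10 ^+ 8 <= quot2 x 2 <= 4 + 552 / 10 ^+ 3 +
  262 / 10 ^+ 6 + 47 / 10 ^+ 8.
  rewrite -[quot2 x 2]/(quot2 x 1 * x + quot x 2).
  by apply: (enclosure_step_neg x0 x_bounds B1 C2); clear; split; lra.
have B3 : 17 + 133 / 10 ^+ 3 + 643 / 10 ^+ 6 + 19 / 10 ^+ 8 <= quot2 x 3 <= 17 + 133 / 10 ^+ 3
  + 644 / 10 ^+ 6 + 3 / 10 ^+ 8.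
  rewrite -[quot2 x 3]/(quot2 x 2 * x + quot x 3).
  by apply: (enclosure_step_pos x0 x_bounds B2 C3); clear; split; lra.
have B4 : 71 + 489 / 10 ^+ 3 + 636 / 10 ^+ 6 + 35 / 10 ^+ 8 <= quot2 x 4 <= 71 + 489 / 10 ^+ 3
  + 640 / 10 ^+ 6 + 91 / 10 ^+ 8.
  rewrite -[quot2 x 4]/(quot2 x 3 * x + quot x 4).
  by apply: (enclosure_step_pos x0 x_bounds B3 C4); clear; split; lra.
have B5 : 302 + 228 / 10 ^+ 3 + 81 / 10 ^+ 6 + 42 / 10 ^+ 8 <= quot2 x 5 <= 302 + 228 / 10 ^+ 3
  + 104 / 10 ^+ 6 + 96 / 10 ^+ 8.
  rewrite -[quot2 x 5]/(quot2 x 4 * x + quot x 5).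
  by apply: (enclosure_step_pos x0 x_bounds B4 C5); clear; split; lra.
have B6 : (1 * 1000 + 275) + 691 / 10 ^+ 3 + 777 / 10 ^+ 6 + 83 / 10 ^+ 8 <= quot2 x 6 <= (1 *
  1000 + 275) + 691 / 10 ^+ 3 + 895 / 10 ^+ 6 + 38 / 10 ^+ 8.
  rewrite -[quot2 x 6]/(quot2 x 5 * x + quot x 6).
  by apply: (enclosure_step_pos x0 x_bounds B5 C6); clear; split; lra.
have B7 : (5 * 1000 + 400) + 604 / 10 ^+ 3 + 545 / 10 ^+ 6 + 66 / 10 ^+ 8 <= quot2 x 7 <= (5 *
  1000 + 400) + 605 / 10 ^+ 3 + 118 / 10 ^+ 6 + 98 / 10 ^+ 8.
  rewrite -[quot2 x 7]/(quot2 x 6 * x + quot x 7).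
  by apply: (enclosure_step_pos x0 x_bounds B6 C7); clear; split; lra.
have B8 : (22 * 1000 + 858) + 301 / 10 ^+ 3 + 6 / 10 ^+ 6 + 83 / 10 ^+ 8 <= quot2 x 8 <= (22 *
  1000 + 858) + 303 / 10 ^+ 3 + 754 / 10 ^+ 6 + 6 / 10 ^+ 8.
  rewrite -[quot2 x 8]/(quot2 x 7 * x + quot x 8).
  by apply: (enclosure_step_pos x0 x_bounds B7 C8); clear; split; lra.
have B9 : (96 * 1000 + 732) + 781 / 10 ^+ 3 + 707 / 10 ^+ 6 + 77 / 10 ^+ 8 <= quot2 x 9 <= (96
  * 1000 + 732) + 794 / 10 ^+ 3 + 692 / 10 ^+ 6 + 13 / 10 ^+ 8.
  rewrite -[quot2 x 9]/(quot2 x 8 * x + quot x 9).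
  by apply: (enclosure_step_pos x0 x_bounds B8 C9); clear; split; lra.
have B10 : (409 * 1000 + 356) + 116 / 10 ^+ 3 + 952 / 10 ^+ 6 + 35 / 10 ^+ 8 <= quot2 x 10 <=
  (409 * 1000 + 356) + 177 / 10 ^+ 3 + 649 / 10 ^+ 6 + 12 / 10 ^+ 8.
  rewrite -[quot2 x 10]/(quot2 x 9 * x + quot x 10).
  by apply: (enclosure_step_pos x0 x_bounds B9 C10); clear; split; lra.
split; [by clear -B9; lra|exact: B10].
Qed.

(* Lower coefficients of - q (X^3 + 5 X^2 + 16 X + 45), constant term first; the
   multiplier is the rounded beginning of the expansion of 1 / q at infinity. *)
Definition filtered_coef (R : pzRingType) (q : nat -> R) : seq R :=
  [:: - (45 * q 10);
      - (16 * q 10 + 45 * q 9);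
      - (5 * q 10 + 16 * q 9 + 45 * q 8);
      - (q 10 + 5 * q 9 + 16 * q 8 + 45 * q 7);
      - (q 9 + 5 * q 8 + 16 * q 7 + 45 * q 6);
      - (q 8 + 5 * q 7 + 16 * q 6 + 45 * q 5);
      - (q 7 + 5 * q 6 + 16 * q 5 + 45 * q 4);
      - (q 6 + 5 * q 5 + 16 * q 4 + 45 * q 3);
      - (q 5 + 5 * q 4 + 16 * q 3 + 45 * q 2);
      - (q 4 + 5 * q 3 + 16 * q 2 + 45 * q 1);
      - (q 3 + 5 * q 2 + 16 * q 1 + 45 * q 0);
      - (q 2 + 5 * q 1 + 16 * q 0);
      - (q 1 + 5 * q 0)].

(** This is the hypothesis of [recurrence_bound] with [rho = 4]. The polynomial q itself fails the
    test, since its second coefficient already exceeds 4 in absolute value. *)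
Lemma filtered_coef_bound (R : realFieldType) (x : R) :
  4 + 231 / 10 ^+ 3 + 836 / 10 ^+ 6 + 358 / 10 ^+ 9 <= x <= 4 + 231 / 10 ^+ 3 + 836 / 10 ^+ 6 +
    359 / 10 ^+ 9 ->
  \sum_(i < 13) `|nth 0 (filtered_coef (quot x)) i| * 4 ^+ i <= 4 ^+ 13.
Proof.
move=> xI; have [[C1 C2 C3 C4 C5] [C6 C7 C8 C9 C10]] := quot_enclosure xI.
have q0 : quot x 0 = 1 by [].
rewrite /filtered_coef !big_ord_recr big_ord0 /= q0.
have N0 : `|- (45 * quot x 10)| <= 534 / 10.
  by clear -C10; rewrite ler_norml; lra.
have N1 : `|- (16 * quot x 10 + 45 * quot x 9)| <= 104 / 10.
  by clear -C9 C10; rewrite ler_norml; lra.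
have N2 : `|- (5 * quot x 10 + 16 * quot x 9 + 45 * quot x 8)| <= (169 + 4 / 10).
  by clear -C8 C9 C10; rewrite ler_norml; lra.
have N3 : `|- (quot x 10 + 5 * quot x 9 + 16 * quot x 8 + 45 * quot x 7)| <= (154 + 9 / 10).
  by clear -C7 C8 C9 C10; rewrite ler_norml; lra.
have N4 : `|- (quot x 9 + 5 * quot x 8 + 16 * quot x 7 + 45 * quot x 6)| <= 953 / 10.
  by clear -C6 C7 C8 C9; rewrite ler_norml; lra.
have N5 : `|- (quot x 8 + 5 * quot x 7 + 16 * quot x 6 + 45 * quot x 5)| <= 521 / 10.
  by clear -C5 C6 C7 C8; rewrite ler_norml; lra.
have N6 : `|- (quot x 7 + 5 * quot x 6 + 16 * quot x 5 + 45 * quot x 4)| <= 650 / 10.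
  by clear -C4 C5 C6 C7; rewrite ler_norml; lra.
have N7 : `|- (quot x 6 + 5 * quot x 5 + 16 * quot x 4 + 45 * quot x 3)| <= (117 + 0 / 10).
  by clear -C3 C4 C5 C6; rewrite ler_norml; lra.
have N8 : `|- (quot x 5 + 5 * quot x 4 + 16 * quot x 3 + 45 * quot x 2)| <= (267 + 6 / 10).
  by clear -C2 C3 C4 C5; rewrite ler_norml; lra.
have N9 : `|- (quot x 4 + 5 * quot x 3 + 16 * quot x 2 + 45 * quot x 1)| <= (117 + 1 / 10).
  by clear -C1 C2 C3 C4; rewrite ler_norml; lra.
have N10 : `|- (quot x 3 + 5 * quot x 2 + 16 * quot x 1 + 45 * 1)| <= 7 / 10.
  by clear -C1 C2 C3; rewrite ler_norml; lra.
have N11 : `|- (quot x 2 + 5 * quot x 1 + 16 * 1)| <= 11 / 10.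
  by clear -C1 C2; rewrite ler_norml; lra.
have N12 : `|- (quot x 1 + 5 * 1)| <= 3 / 10.
  by clear -C1; rewrite ler_norml; lra.
by clear -N0 N1 N2 N3 N4 N5 N6 N7 N8 N9 N10 N11 N12; lra.
Qed.

Lemma filtered_recurrence (R : comPzRingType) (q u : nat -> R) : q 0%N = 1 ->
  (forall n, \sum_(i < 11) q i * u (n + 10 - i)%N = 0) ->
  forall n, u (n + 13)%N = \sum_(i < 13) nth 0 (filtered_coef q) i * u (n + i)%N.
Proof.
move=> q0 Hu n; have := Hu n; have := Hu n.+1; have := Hu n.+2; have := Hu n.+3.
rewrite !big_ord_recr !big_ord0 /= !addnS !subSS !addn0 !subn0 q0.
set S3 := (X in X = 0 -> _); set S2 := (X in _ -> X = 0 -> _).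
set S1 := (X in _ -> _ -> X = 0 -> _); set S0 := (X in _ -> _ -> _ -> X = 0 -> _).
move=> H3 H2 H1 H0; apply/eqP; rewrite -subr_eq0; apply/eqP.
(* Weighting four consecutive instances by 1, 5, 16 and 45 multiplies the characteristic polynomial
   by [X^3 + 5 X^2 + 16 X + 45]. *)
transitivity (S3 + 5 * S2 + 16 * S1 + 45 * S0); first by rewrite /S3 /S2 /S1 /S0; ring.
by rewrite H3 H2 H1 H0; ring.
Qed.

(** * Asymptotics *)

Lemma cvg_shifted_ratio (R : realType) (u : nat -> R) (x : R) (j : nat) : x != 0 ->
  (fun n => u n / x ^+ n) @ \oo --> (0 : R) ->
  (fun n => u (n + j)%N / x ^+ n) @ \oo --> (0 : R).
Proof.
move=> x0 u0; have -> : (fun n => u (n + j)%N / x ^+ n)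
    = (fun n => x ^+ j * (u (n + j)%N / x ^+ (n + j))).
  by apply/funext => n; rewrite exprD; field; rewrite !expf_neq0.
rewrite -[X in _ --> X](mulr0 (x ^+ j)); apply: cvgM; first exact: cvg_cst.
by rewrite (cvg_shiftn j (fun n => u n / x ^+ n)).
Qed.

Lemma cvg_lincomb0 (R : realType) (c : nat -> R) (f : nat -> nat -> R) (m : nat) :
  (forall i, f i @ \oo --> (0 : R)) ->
  (fun n => \sum_(i < m) c i * f i n) @ \oo --> (0 : R).
Proof.
move=> f0; elim: m => [|m IH].
  by under eq_fun do rewrite big_ord0; apply: cvg_cst.
under eq_fun do rewrite big_ord_recr /=.
suff : (fun n => \sum_(i < m) c i * f i n + c m * f m n) @ \oo --> 0 + c m * (0 : R).
  by rewrite mulr0 addr0.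
by apply: cvgD => //; apply: cvgM => //; apply: cvg_cst.
Qed.

Lemma cvg_dominant_root (R : realType) (k : nat -> R) (x : R) :
  4 + 231 / 10 ^+ 3 + 836 / 10 ^+ 6 + 358 / 10 ^+ 9 <= x
    <= 4 + 231 / 10 ^+ 3 + 836 / 10 ^+ 6 + 359 / 10 ^+ 9 ->
  quot x 11 = 0 ->
  (forall n, \sum_(i < 12) char_coef R i * k (n + 11 - i)%N = 0) ->
  (fun n => k n / x ^+ n) @ \oo -->
    (\sum_(i < 11) quot x i * k (10 - i)%N) / quot2 x 10.
Proof.
move=> xI root rec; pose u n := k n.+1 - x * k n.
have x0 : 0 < x by lra.
have x0' : x != 0 by rewrite gt_eqF.
have [_ q2I] := quot2_enclosure xI.
have q20 : quot2 x 10 != 0 by rewrite gt_eqF //; clear -q2I; lra.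
(* [L] applies q to the shifted sequence; as chi is [(X - x)] times q, it is geometric of ratio
   [x]. *)
pose L n := \sum_(i < 11) quot x i * k (n + 10 - i)%N.
have Hu n : \sum_(i < 11) quot x i * u (n + 10 - i)%N = 0.
  have := synthetic_division (char_coef R) x (fun i => k (n + 11 - i)%N) 11.
  rewrite -/(quot x) root mul0r subr0 rec => E; rewrite -[RHS]E; apply: eq_bigr => i _.
  rewrite /u; congr (_ * (k _ - _ * k _)); move: (ltn_ord i); clear; lia.
have LS n : L n.+1 = x * L n.
  apply/eqP; rewrite -subr_eq0; apply/eqP; rewrite -[RHS](Hu n) /L mulr_sumr -sumrB.
  apply: eq_bigr => i _; rewrite /u mulrBr mulrCA.
  by congr (_ * k _ - _); move: (ltn_ord i); clear; lia.
have LE n : L n = x ^+ n * L 0%N.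
  by elim: n => [|n IH]; rewrite ?mul1r // LS IH exprS mulrA.
(* Dividing q by [X - x] recovers [k n] from [L n] up to finitely many values of [u]; the remainder
   supplies the factor [quot2 x 10]. *)
have kE n : quot2 x 10 * k n = L n - \sum_(i < 10) quot2 x i * u (n + (9 - i))%N.
  have := synthetic_division (quot x) x (fun i => k (n + 10 - i)%N) 10.
  rewrite -/(quot2 x) addnK -/(L n) => E; apply/eqP; rewrite -subr_eq0.
  rewrite (_ : \sum_(i < 10) _ = L n - quot2 x 10 * k n); first by apply/eqP; ring.
  rewrite -E; apply: eq_bigr => i _; rewrite /u.
  by congr (_ * (k _ - _ * k _)); move: (ltn_ord i); clear; lia.
have [C uC] : exists C, forall n, `|u n| <= C * 4 ^+ n.
  apply: (recurrence_bound (d := fun i : 'I_13 => nth 0 (filtered_coef (quot x)) i)) => //.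
    exact: filtered_coef_bound.
  exact: filtered_recurrence.
have u0 : (fun n => u n / x ^+ n) @ \oo --> (0 : R).
  by apply: cvg_geometric_bound uC; clear -xI; lra.
have -> : (fun n => k n / x ^+ n) = (fun n => (L 0%N - \sum_(i < 10)
    quot2 x i * (u (n + (9 - i))%N / x ^+ n)) / quot2 x 10).
  apply/funext => n; apply: (mulfI q20); rewrite mulrA kE LE mulrBl.
  rewrite [RHS]mulrC divfK // mulr_suml [x ^+ n * _]mulrC mulfK ?expf_neq0 //.
  by congr (_ - _); apply: eq_bigr => i _; rewrite mulrA.
apply: cvgM; last exact: cvg_cst.
rewrite -[X in _ --> X]subr0; apply: cvgB; first exact: cvg_cst.
apply: (@cvg_lincomb0 _ (quot2 x) (fun i n => u (n + (9 - i))%N / x ^+ n)) => i.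
exact: cvg_shifted_ratio.
Qed.

Lemma num_cheesy_values (R : pzRingType) :
  let k i := (num_cheesy 2 i)%:R : R in
  [/\ k 2%N = 3, k 3%N = 11, k 4%N = 43, k 5%N = 174 & k 6%N = 718] /\
  [/\ k 7%N = 2 * 1000 + 996, k 8%N = 12 * 1000 + 579, k 9%N = 52 * 1000 + 996,
    k 10%N = 223 * 1000 + 705
    & k 11%N = 945 * 1000 + 324 /\ k 12%N = (3 * 1000 + 997) * 1000 + 185].
Proof.
have [[e2 e3 e4 e5 e6] [e7 e8 e9 e10 [e11 e12]]] := total_values.
have E i := num_cheesy_total i.
have thousands (a b i : nat) : total i = a%:Z * 1000 + b%:Z ->
    (num_cheesy 2 i)%:R = a%:R * 1000 + b%:R :> R.
  rewrite -num_cheesy_total => h; rewrite -natrM -natrD; congr _%:R; lia.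
have units (a i : nat) : total i = a%:Z -> (num_cheesy 2 i)%:R = a%:R :> R.
  by rewrite -num_cheesy_total => -[->].
move=> k; split; split.
- exact: units e2.
- exact: units e3.
- exact: units e4.
- exact: units e5.
- exact: units e6.
- exact: (@thousands 2%N 996%N) e7.
- exact: (@thousands 12%N 579%N) e8.
- exact: (@thousands 52%N 996%N) e9.
- exact: (@thousands 223%N 705%N) e10.
- split; first exact: (@thousands 945%N 324%N) e11.
  rewrite -natrM -natrD; apply: (@thousands (3 * 1000 + 997)%N 185%N).
  rewrite e12; lia.
Qed.

Lemma num_cheesy_rec (R : comPzRingType) (n : nat) :
  \sum_(i < 12) char_coef R i * (num_cheesy 2 (n + 11 - i).+2)%:R = 0.
Proof.
have E i : (num_cheesy 2 i)%:R = (total i)%:~R :> R by rewrite -num_cheesy_total.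
under eq_bigr do rewrite E.
have := congr1 (fun z : int => z%:~R : R) (total_rec n).
rewrite !(rmorphB, rmorphD, rmorphM, rmorph_nat) /=.
rewrite !big_ord_recr big_ord0 /= /char_coef /= !addnS !subSS !addn0 !subn0 => ->.
ring.
Qed.

Theorem corollary3 (R : realType) :
  exists kappa lambda : R,
    [/\ 121 / 10 ^+ 3 + 42 / 10 ^+ 6 <= kappa < 121 / 10 ^+ 3 + 43 / 10 ^+ 6,
        4 + 231 / 10 ^+ 3 + 836 / 10 ^+ 6 <= lambda
          < 4 + 231 / 10 ^+ 3 + 837 / 10 ^+ 6 &
        (fun n : nat => (num_cheesy 2 n)%:R / (kappa * lambda ^+ n))
          @ \oo --> (1 : R)].
Proof.
have [x xI root] := dominant_root R.
(* The recurrence holds from two cells on; the shift by 2 is why [kappa] will be [c / x ^+ 2]. *)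
pose k n : R := (num_cheesy 2 n.+2)%:R.
have kx := cvg_dominant_root xI root (num_cheesy_rec R : forall n,
  \sum_(i < 12) char_coef R i * k (n + 11 - i)%N = 0).
set c := _ / _ in kx.
have x0 : 0 < x by clear -xI; lra.
have [_ q2I] := quot2_enclosure xI.
have q20 : 0 < quot2 x 10 by clear -q2I; lra.
have cI : (121 / 10 ^+ 3 + 42 / 10 ^+ 6) * x ^+ 2 <= c
    < (121 / 10 ^+ 3 + 43 / 10 ^+ 6) * x ^+ 2.
  rewrite /c ler_pdivlMr // ltr_pdivrMr // !big_ord_recr big_ord0 /= /k.
  have [[-> -> -> -> ->] [-> -> -> -> [-> ->]]] := num_cheesy_values R.
  have [[C1 C2 C3 C4 C5] [C6 C7 C8 C9 C10]] := quot_enclosure xI.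
  have -> : quot x 0 = 1 by [].
  have l0 : 0 <= 4 + 231 / 10 ^+ 3 + 836 / 10 ^+ 6 + 358 / 10 ^+ 9 :> R by clear; lra.
  have lo0 : 0 <= 409 * 1000 + 356 + 116 / 10 ^+ 3 + 952 / 10 ^+ 6 + 35 / 10 ^+ 8 :> R.
    by clear; lra.
  (* Enclosing [quot2 x 10 * x * x] as a single quantity makes the final inequalities linear in it
     and in the coefficients of q. *)
  have p1 := mul_enclosure_pos l0 lo0 xI q2I.
  have p2 := mul_enclosure_pos l0 (mulr_ge0 lo0 l0) xI p1.
  have PE (d : R) : d * x ^+ 2 * quot2 x 10 = d * (quot2 x 10 * x * x) by ring.
  rewrite !PE; move: (quot2 x 10 * x * x) p2 => P p2.
  by clear -p2 C1 C2 C3 C4 C5 C6 C7 C8 C9 C10; apply/andP; split; lra.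
clearbody c; have c0 : 0 < c.
  by case/andP: cI => h _; apply: lt_le_trans h; rewrite mulr_gt0 ?exprn_gt0 //; clear; lra.
exists (c / x ^+ 2), x; split.
- by rewrite ler_pdivlMr ?exprn_gt0 // ltr_pdivrMr ?exprn_gt0.
- by clear -xI; lra.
(* Reading the sequence from index 2 cancels the factor [x ^+ 2] against the one in [kappa]. *)
rewrite -(cvg_shiftn 2).
have -> : (fun n => (num_cheesy 2 (n + 2))%:R / (c / x ^+ 2 * x ^+ (n + 2)))
    = (fun n => k n / x ^+ n * c^-1).
  apply/funext => n; rewrite /k exprD [in num_cheesy _ _]addn2.
  have y0 : x ^+ n != 0 by rewrite expf_neq0 // gt_eqF.
  move: (num_cheesy 2 n.+2)%:R (x ^+ n) y0 => a y y0.
  by field; rewrite y0 !gt_eqF.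
suff : (fun n => k n / x ^+ n * c^-1) @ \oo --> c * c^-1 by rewrite divff ?lt0r_neq0.
by apply: cvgM => //; apply: cvg_cst.
Qed.
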